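(* Let $(R,\mathfrak m)$ be a (commutative Noetherian) local Gorenstein ring of dimension one whose $\mathfrak m$-adic completion is reduced. Then $\operatorname{ca}(R)=\operatorname{ca}^n(R)=\mathcal C(R)$ for every $n\ge 2$.
   Context: $\operatorname{mod} R$ is the category of finitely generated $R$-modules, and $\operatorname{ann}_R X=\{r\in R: rX=0\}$ for an $R$-module $X$. For an integer $n\ge1$, $$\operatorname{ca}^n(R)=\bigcap_{X,Y\in\operatorname{mod} R}\ \bigcap_{i\ge n}\operatorname{ann}_R\operatorname{Ext}^i_R(X,Y),$$ and the cohomology annihilator is $\operatorname{ca}(R)=\bigcup_{n\ge1}\operatorname{ca}^n(R)$ (an increasing union of ideals of $R$). $Q(R)$ is the total ring of fractions of $R$ (localization at all non-zero-divisors), $\overline R$ is the integral closure of $R$ in $Q(R)$, and the conductor is $\mathcal C(R)=(R:\overline R)=\{x\in Q(R): x\overline R\subseteq R\}$, an ideal of $R$. *)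

(* Defs.v *)
From HB Require Import structures.
From mathcomp Require Import all_boot all_order all_algebra.
From mathcomp Require Import generic_quotient ring_quotient.
From mathcomp Require Import boolp classical_sets functions.
From mathcomp Require Import ring.

Set Implicit Arguments.
Unset Strict Implicit.
Unset Printing Implicit Defensive.

Import GRing.Theory.

Local Open Scope ring_scope.
Local Open Scope quotient_scope.
Local Open Scope classical_set_scope.

(* ring_quotient.v provides the quotient of the underlying additive groups, to
   which we add the scaling. *)
Section QuotientModule.
Variables (R : pzRingType) (V : lmodType R) (S : submodClosed V).

(* GRing.SubmodClosed is stated for semirings and does not inherit from
   GRing.ZmodClosed. *)
Definition submod_pred : {pred V} := S.

HB.instance Definition _ := GRing.isZmodClosed.Build V submod_pred
  (GRing.submod_closedB (submodClosedP S)).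

Local Notation Q := (Quotient.quot submod_pred).

Definition quot_scale (a : R) (q : Q) : Q := \pi_Q (a *: repr q).

Lemma quot_scale_pi a v : quot_scale a (\pi_Q v) = \pi_Q (a *: v).
Proof.
apply/eqP; rewrite /quot_scale -Quotient.idealrBE -scalerBr.
apply: (rpredZ (s := S)); change (repr (\pi_Q v) - v \in submod_pred).
by rewrite Quotient.idealrBE reprK.
Qed.

Fact quot_piP (q : Q) : exists v, q = \pi_Q v.
Proof. by exists (repr q); rewrite reprK. Qed.

Fact quot_piD u v : \pi_Q (u + v) = \pi_Q u + \pi_Q v.
Proof. exact: (raddfD \pi_Q). Qed.

Lemma quot_pi_eq0 v : (\pi_Q v == 0) = (v \in S).
Proof.
have -> : (0 : Q) = \pi_Q 0 by rewrite (raddf0 \pi_Q).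
by rewrite -Quotient.idealrBE subr0.
Qed.

Fact quot_scalerA a b q :
  quot_scale a (quot_scale b q) = quot_scale (a * b) q.
Proof.
by have [v ->] := quot_piP q; rewrite (quot_scale_pi b) !quot_scale_pi scalerA.
Qed.

Fact quot_scale1r : left_id 1 quot_scale.
Proof.
by move=> q; have [v ->] := quot_piP q; rewrite quot_scale_pi scale1r.
Qed.

Fact quot_scalerDr : right_distributive quot_scale +%R.
Proof.
move=> a p q; have [[u ->] [v ->]] := (quot_piP p, quot_piP q).
by rewrite -quot_piD !quot_scale_pi scalerDr quot_piD.
Qed.

Fact quot_scalerDl q : {morph quot_scale^~ q : a b / a + b}.
Proof.
move=> a b; have [v ->] := quot_piP q.
by rewrite !quot_scale_pi scalerDl quot_piD.
Qed.

HB.instance Definition _ := GRing.Zmodule_isLmodule.Build R Q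
  quot_scalerA quot_scale1r quot_scalerDr quot_scalerDl.
End QuotientModule.

Section Modules.
Variable R : comNzRingType.

Definition span (M : lmodType R) (s : seq M) : set M :=
  [set x | exists c : 'I_(size s) -> R, x = \sum_i c i *: s`_i].

Definition fin_gen (M : lmodType R) : Prop :=
  exists s : seq M, span s = [set: M].

Definition projective_module (P : lmodType R) : Prop :=
  forall (A B : lmodType R) (p : {linear A -> B}) (f : {linear P -> B}),
    (forall b, exists a, p a = b) ->
    exists g : {linear P -> A}, forall x, p (g x) = f x.

Definition injective_module (J : lmodType R) : Prop :=
  forall (A B : lmodType R) (i : {linear A -> B}) (f : {linear A -> J}),
    injective i ->
    exists g : {linear B -> J}, forall x, g (i x) = f x.

(* 0 -> M -> J^0 -> ... -> J^n -> 0, split into short exact sequences *)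
Fixpoint inj_dim_le (n : nat) (M : lmodType R) : Prop :=
  match n with
  | 0 => injective_module M
  | n'.+1 =>
    exists (J C : lmodType R) (i : {linear M -> J}) (p : {linear J -> C}),
      [/\ injective_module J, injective i,
          (forall c, exists x, p x = c),
          (forall x, p x = 0 <-> exists y, x = i y)
        & inj_dim_le n' C]
  end.

Record proj_resolution (X : lmodType R) := ProjResolution {
  res_mod :> nat -> lmodType R;
  res_diff : forall n, {linear res_mod n.+1 -> res_mod n};
  res_aug : {linear res_mod 0%N -> X};
  res_proj : forall n, projective_module (res_mod n);
  res_aug_surj : forall x, exists p, res_aug p = x;
  res_exact0 : forall p, res_aug p = 0 <-> exists q, p = res_diff 0 q;
  res_exact : forall n p,
    res_diff n p = 0 <-> exists q, p = res_diff n.+1 q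
}.

End Modules.

Section Ext.
Variables (R : comNzRingType) (X Y : lmodType R) (P : proj_resolution X).
Variable i : nat.

(* cocycles of degree i in the complex Hom_R(P, Y) *)
Definition ext_cocycle : {pred P i -> Y} :=
  fun f => `[< linear f /\ forall x, f (res_diff P i x) = 0 >].

Fact ext_cocycle_closed : subsemimod_closed ext_cocycle.
Proof.
split.
  split; first by apply/asboolP; split=> [a x y|x] //=; rewrite scaler0 addr0.
  move=> f g /asboolP[fl f0] /asboolP[gl g0]; apply/asboolP; split=> [a x y|x].
    by rewrite !addrfctE fl gl scalerDr addrACA.
  by rewrite addrfctE f0 g0 addr0.
move=> b f /asboolP[fl f0]; apply/asboolP; split=> [a x y|x].
  by rewrite !scalrfctE fl scalerDr !scalerA mulrC.
by rewrite scalrfctE f0 scaler0.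
Qed.

HB.instance Definition _ :=
  GRing.isSubmodClosed.Build R (P i -> Y) ext_cocycle ext_cocycle_closed.

Record cocycle := Cocycle {
  cocycle_val :> P i -> Y;
  _ : cocycle_val \in ext_cocycle }.

HB.instance Definition _ := [isSub for cocycle_val].
HB.instance Definition _ := [Choice of cocycle by <:].
HB.instance Definition _ := [SubChoice_isSubLmodule of cocycle by <:].

End Ext.

Section Ext2.
Variables (R : comNzRingType) (X Y : lmodType R) (P : proj_resolution X).

Definition ext_coboundary (i : nat) : {pred cocycle Y P i} :=
  match i with
  | 0 => fun f => f == 0
  | j.+1 => fun f =>
      `[< exists g : {linear P j -> Y}, forall x, f x = g (res_diff P j x) >]
  end.

Fact ext_coboundary_closed i : subsemimod_closed (@ext_coboundary i).
Proof.
case: i => [|j].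
  split; first split.
  - exact: eqxx.
  - by move=> f g /eqP-> /eqP->; rewrite addr0; exact: eqxx.
  - by move=> a f /eqP->; rewrite scaler0; exact: eqxx.
split; first split.
- by apply/asboolP; exists \0%R.
- move=> f g /asboolP[f' ff'] /asboolP[g' gg']; apply/asboolP.
  by exists (f' \+ g')%R => x /=; rewrite addrfctE ff' gg'.
move=> a f /asboolP[f' ff']; apply/asboolP.
by exists (a \*: f')%R => x /=; rewrite scalrfctE ff'.
Qed.

HB.instance Definition _ i :=
  GRing.isSubmodClosed.Build R (cocycle Y P i) (@ext_coboundary i)
    (@ext_coboundary_closed i).

(* Ext^i_R(X, Y), computed as H^i(Hom_R(P, Y)) for a projective resolution P
   of X *)
Definition Ext (i : nat) : lmodType R :=
  Quotient.quot (submod_pred (@ext_coboundary i)).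

End Ext2.

Section CohomologyAnnihilator.
Variable R : comNzRingType.

Definition annihilator (M : lmodType R) : set R :=
  [set r | forall x : M, r *: x = 0].

(* The annihilator of Ext does not depend on the resolution; we require the
   vanishing for all of them. *)
Definition ca_ (n : nat) : set R :=
  [set r | forall X Y : lmodType R, fin_gen X -> fin_gen Y ->
    forall (P : proj_resolution X) (i : nat), (n <= i)%N ->
      annihilator (Ext Y P i) r].

Definition ca : set R := \bigcup_(n in [set n | (1 <= n)%N]) ca_ n.

End CohomologyAnnihilator.

Arguments ca_ : clear implicits.
Arguments ca : clear implicits.

Section Rings.
Variable R : comNzRingType.
Implicit Types I J p m : set R.

Definition ideal I : Prop := submod_closed ([in I] : {pred R^o}).

(* in ring_quotient.v, idealr_closed includes being proper *)
Definition prime_ideal p : Prop :=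
  idealr_closed [in p] /\ prime_idealr_closed [in p].

Definition maximal_ideal m : Prop :=
  idealr_closed [in m] /\
  forall J, idealr_closed [in J] -> m `<=` J -> J = m.

Definition noetherian : Prop :=
  forall I, ideal I -> exists s : seq R^o, I = span s.

Definition local_ring m : Prop :=
  maximal_ideal m /\ forall m', maximal_ideal m' -> m' = m.

(* finite self-injective dimension defines Gorenstein rings only in the
   Noetherian local case *)
Definition gorenstein_local m : Prop :=
  [/\ noetherian, local_ring m & exists n, inj_dim_le n (R^o : lmodType R)].

Definition prime_chain (n : nat) : Prop :=
  exists p : nat -> set R,
    (forall i, (i <= n)%N -> prime_ideal (p i)) /\
    (forall i, (i < n)%N -> p i `<` p i.+1).

Definition krull_dim (d : nat) : Prop := prime_chain d /\ ~ prime_chain d.+1.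

Definition ideal_mul I J : set R :=
  smallest ideal [set x | exists a b, [/\ I a, J b & x = a * b]].

Definition ideal_exp I (n : nat) : set R := iter n (ideal_mul I) [set: R].

Lemma ideal_ideal_exp I n : ideal (ideal_exp I n).
Proof.
case: n => [|n] /=; first by split=> [|a x y _ _]; rewrite inE.
split=> [|a x y]; rewrite !inE.
  by move=> A [[A0 _] _]; rewrite inE in A0.
move=> Ix Iy A hA; have [[_ cA] _] := hA.
by have := cA a x y; rewrite !inE; apply; [exact: Ix|exact: Iy].
Qed.

Definition reduced (S : comNzRingType) : Prop :=
  forall (x : S) (n : nat), x ^+ n = 0 -> x = 0.

End Rings.

Arguments noetherian : clear implicits.
Arguments krull_dim : clear implicits.

(* The inverse limit of the rings R / m^n, presented as the ring of sequences
   x with x (n+1) = x n mod m^n, modulo the sequences with x n in m^n for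
   all n. *)
Section Completion.
Variables (R : comNzRingType) (m : idealr R).
Local Notation m_ n := (ideal_exp [set` m] n).

Let m_D n x y : m_ n x -> m_ n y -> m_ n (x + y).
Proof.
have [_ c] := ideal_ideal_exp [set` m] n => hx hy.
by have := c 1 x y; rewrite scale1r !inE; apply.
Qed.

Let m_0 n : m_ n 0.
Proof. by have [c _] := ideal_ideal_exp [set` m] n; rewrite inE in c. Qed.

Let m_M n a x : m_ n x -> m_ n (a * x).
Proof.
have [c0 c] := ideal_ideal_exp [set` m] n => hx.
have := c a x 0; rewrite addr0 !inE; apply=> //; exact: m_0.
Qed.

Let m_N n x : m_ n x -> m_ n (- x).
Proof. by move=> ?; rewrite -mulN1r; exact: m_M. Qed.

Definition coherent : {pred nat -> R} :=
  fun x => `[< forall n, m_ n (x n.+1 - x n) >].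

Fact coherent_closed : subring_closed coherent.
Proof.
split.
- by apply/asboolP=> n; rewrite subrr; exact: m_0.
- move=> x y /asboolP cx /asboolP cy; apply/asboolP=> n.
  rewrite !fctE opprD addrACA -opprD.
  by apply: m_D => //; exact: m_N.
- move=> x y /asboolP cx /asboolP cy; apply/asboolP=> n.
  rewrite !fctE -[_ - _](subrKA (x n * y n.+1)) -mulrBl -mulrBr.
  by apply: m_D; [rewrite mulrC|]; exact: m_M.
Qed.

HB.instance Definition _ :=
  GRing.isSubringClosed.Build (nat -> R) coherent coherent_closed.

Record coherent_seq := CoherentSeq {
  coherent_val :> nat -> R;
  _ : coherent_val \in coherent }.

HB.instance Definition _ := [isSub for coherent_val].
HB.instance Definition _ := [Choice of coherent_seq by <:].
HB.instance Definition _ := [SubChoice_isSubComNzRing of coherent_seq by <:].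

Definition null_seq : {pred coherent_seq} :=
  fun x => `[< forall n, m_ n (x n) >].

Fact null_seq_closed : idealr_closed null_seq.
Proof.
split.
- by apply/asboolP=> n; exact: m_0.
- apply/negP => /asboolP /(_ 1%N) /= h.
  have : [set` m] 1; last by rewrite /= idealr1.
  apply: (h [set` m]); split.
    split=> [|a x y]; first by rewrite !inE /= idealr0.
    by rewrite !inE /= => mx my; rewrite rpredD // idealMr.
  by move=> _ [a [b [ma _ ->]]] /=; rewrite mulrC idealMr.
- move=> a x y /asboolP nx /asboolP ny; apply/asboolP=> n.
  by apply: m_D => //; exact: m_M.
Qed.

HB.instance Definition _ :=
  isIdealr.Build coherent_seq null_seq null_seq_closed.

Definition completion : comNzRingType := {ideal_quot null_seq}.

End Completion.

Section TotalFractions.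
Variable R : comNzRingType.

Definition nonzerodivisor : pred R := fun s => `[< GRing.lreg s >].

Record tf_ratio := TfRatio {
  num : R;
  den : R;
  den_reg : nonzerodivisor den }.

HB.instance Definition _ := gen_eqMixin tf_ratio.
HB.instance Definition _ := gen_choiceMixin tf_ratio.

Fact den_inj (x : tf_ratio) : injective ( *%R (den x)).
Proof. by case: x => a s /= /asboolP. Qed.

Definition tf_ratio_equiv (x y : tf_ratio) : bool :=
  num x * den y == num y * den x.

Fact tf_ratio_equiv_refl : reflexive tf_ratio_equiv.
Proof. by move=> x; exact: eqxx. Qed.

Fact tf_ratio_equiv_sym : symmetric tf_ratio_equiv.
Proof. by move=> x y; exact: eq_sym. Qed.

Fact tf_ratio_equiv_trans : transitive tf_ratio_equiv.
Proof.
move=> y x z /eqP xy /eqP yz; apply/eqP/(@den_inj y).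
by rewrite mulrCA mulrA xy mulrAC yz -mulrA mulrCA.
Qed.

Canonical tf_ratio_equiv_equiv :=
  EquivRel tf_ratio_equiv
    tf_ratio_equiv_refl tf_ratio_equiv_sym tf_ratio_equiv_trans.

Definition total_fractions := {eq_quot tf_ratio_equiv}.
Local Notation Q := total_fractions.

HB.instance Definition _ : EqQuotient _ tf_ratio_equiv Q := EqQuotient.on Q.
HB.instance Definition _ := Choice.on Q.

Fact tf_piE (x y : tf_ratio) :
  num x * den y = num y * den x -> \pi_Q x = \pi_Q y.
Proof. by move=> e; apply/eqP; rewrite eqmodE; apply/eqP. Qed.

Fact tf_piI (x y : tf_ratio) :
  \pi_Q x = \pi_Q y -> num x * den y = num y * den x.
Proof. by move=> /eqP; rewrite eqmodE => /eqP. Qed.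

Fact tf_reprE (x : tf_ratio) :
  num (repr (\pi_Q x)) * den x = num x * den (repr (\pi_Q x)).
Proof. by apply: tf_piI; rewrite reprK. Qed.

Fact nonzerodivisorM s t :
  nonzerodivisor s -> nonzerodivisor t -> nonzerodivisor (s * t).
Proof. by move=> /asboolP ? /asboolP ?; apply/asboolP/lregM. Qed.

Fact nonzerodivisor1 : nonzerodivisor 1.
Proof. by apply/asboolP; exact: lreg1. Qed.

Definition tf_ratio_add (x y : tf_ratio) : tf_ratio :=
  TfRatio (num x * den y + num y * den x)
    (nonzerodivisorM (den_reg x) (den_reg y)).

Definition tf_ratio_opp (x : tf_ratio) : tf_ratio :=
  TfRatio (- num x) (den_reg x).

Definition tf_ratio_mul (x y : tf_ratio) : tf_ratio :=
  TfRatio (num x * num y) (nonzerodivisorM (den_reg x) (den_reg y)).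

Definition tf_add (p q : Q) : Q := \pi_Q (tf_ratio_add (repr p) (repr q)).
Definition tf_opp (p : Q) : Q := \pi_Q (tf_ratio_opp (repr p)).
Definition tf_mul (p q : Q) : Q := \pi_Q (tf_ratio_mul (repr p) (repr q)).

Definition tf_embed (r : R) : Q := \pi_Q (TfRatio r nonzerodivisor1).

Fact tf_addE x y : tf_add (\pi_Q x) (\pi_Q y) = \pi_Q (tf_ratio_add x y).
Proof.
apply: tf_piE => /=; have := tf_reprE x; have := tf_reprE y.
move: (repr _) (repr _) => x' y' ey ex; rewrite !mulrDl; congr (_ + _).
  by rewrite mulrACA ex [den y' * _]mulrC mulrACA.
by rewrite [den x * _]mulrC mulrACA ey; ring.
Qed.

Fact tf_mulE x y : tf_mul (\pi_Q x) (\pi_Q y) = \pi_Q (tf_ratio_mul x y).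
Proof.
apply: tf_piE => /=; have := tf_reprE x; have := tf_reprE y.
by move: (repr _) (repr _) => x' y' ey ex; rewrite mulrACA ex ey mulrACA.
Qed.

Fact tf_oppE x : tf_opp (\pi_Q x) = \pi_Q (tf_ratio_opp x).
Proof. by apply: tf_piE => /=; rewrite !mulNr tf_reprE. Qed.

Fact tf_piP (q : Q) : exists x, q = \pi_Q x.
Proof. by exists (repr q); rewrite reprK. Qed.

Fact tf_addA : associative tf_add.
Proof.
move=> p q r.
have [[x ->] [y ->] [z ->]] := And3 (tf_piP p) (tf_piP q) (tf_piP r).
rewrite [tf_add (\pi y) _]tf_addE [tf_add (\pi x) (\pi y)]tf_addE !tf_addE.
by apply: tf_piE => /=; ring.
Qed.

Fact tf_addC : commutative tf_add.
Proof.
move=> p q; have [[x ->] [y ->]] := (tf_piP p, tf_piP q).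
by rewrite !tf_addE; apply: tf_piE => /=; ring.
Qed.

Fact tf_add0 : left_id (tf_embed 0) tf_add.
Proof.
by move=> p; have [x ->] := tf_piP p; rewrite tf_addE;
  apply: tf_piE => /=; ring.
Qed.

Fact tf_addN : left_inverse (tf_embed 0) tf_opp tf_add.
Proof.
move=> p; have [x ->] := tf_piP p; rewrite tf_oppE tf_addE.
by apply: tf_piE => /=; ring.
Qed.

HB.instance Definition _ :=
  GRing.isZmodule.Build Q tf_addA tf_addC tf_add0 tf_addN.

Fact tf_mulA : associative tf_mul.
Proof.
move=> p q r.
have [[x ->] [y ->] [z ->]] := And3 (tf_piP p) (tf_piP q) (tf_piP r).
rewrite [tf_mul (\pi y) _]tf_mulE [tf_mul (\pi x) (\pi y)]tf_mulE !tf_mulE.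
by apply: tf_piE => /=; ring.
Qed.

Fact tf_mulC : commutative tf_mul.
Proof.
move=> p q; have [[x ->] [y ->]] := (tf_piP p, tf_piP q).
by rewrite !tf_mulE; apply: tf_piE => /=; ring.
Qed.

Fact tf_mul1 : left_id (tf_embed 1) tf_mul.
Proof.
by move=> p; have [x ->] := tf_piP p; rewrite tf_mulE;
  apply: tf_piE => /=; ring.
Qed.

Fact tf_mulD : left_distributive tf_mul tf_add.
Proof.
move=> p q r.
have [[x ->] [y ->] [z ->]] := And3 (tf_piP p) (tf_piP q) (tf_piP r).
rewrite [tf_add (\pi x) _]tf_addE [tf_mul (\pi x) _]tf_mulE.
rewrite [tf_mul (\pi y) _]tf_mulE.
by rewrite tf_mulE tf_addE; apply: tf_piE => /=; ring.
Qed.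

Fact tf_oner_neq0 : tf_embed 1 != 0.
Proof.
by apply/eqP => /tf_piI /=; rewrite !mulr1 => /eqP; rewrite oner_eq0.
Qed.

HB.instance Definition _ := GRing.Zmodule_isComNzRing.Build Q
  tf_mulA tf_mulC tf_mul1 tf_mulD tf_oner_neq0.

Fact tf_embed_zmod_morphism : zmod_morphism tf_embed.
Proof.
move=> r s; rewrite [- tf_embed s]tf_oppE [tf_embed r + _]tf_addE.
by apply: tf_piE => /=; ring.
Qed.

Fact tf_embed_monoid_morphism : monoid_morphism tf_embed.
Proof.
split=> // r s; rewrite [RHS]tf_mulE.
by apply: tf_piE => /=; ring.
Qed.

HB.instance Definition _ :=
  GRing.isZmodMorphism.Build R Q tf_embed tf_embed_zmod_morphism.
HB.instance Definition _ :=
  GRing.isMonoidMorphism.Build R Q tf_embed tf_embed_monoid_morphism.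

Lemma tf_embed_inj : injective tf_embed.
Proof. by move=> r s /tf_piI /=; rewrite !mulr1. Qed.

Lemma tf_embed_unit s : GRing.lreg s -> exists q, tf_embed s * q = 1.
Proof.
move=> /asboolP sP; exists (\pi_Q (TfRatio 1 sP)).
by rewrite [LHS]tf_mulE; apply: tf_piE => /=; ring.
Qed.

Lemma total_fractionsP (q : Q) :
  exists r s, GRing.lreg s /\ q * tf_embed s = tf_embed r.
Proof.
have [[r s sP] ->] := tf_piP q; exists r, s; split; first exact/asboolP.
by rewrite [LHS]tf_mulE; apply: tf_piE => /=; ring.
Qed.

Definition integral_closure : set total_fractions := integralOver tf_embed.

Definition conductor : set total_fractions :=
  [set x | forall y, integral_closure y -> exists r, x * y = tf_embed r].

End TotalFractions.

Arguments conductor : clear implicits.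

(* Main.v *)
From HB Require Import structures.
Require Import Defs.
From mathcomp Require Import all_boot all_order all_algebra.
From mathcomp Require Import generic_quotient ring_quotient boolp classical_sets.
From mathcomp Require Import ring.

Set Implicit Arguments.
Unset Strict Implicit.
Unset Printing Implicit Defensive.

Import GRing.Theory.

Local Open Scope ring_scope.
Local Open Scope quotient_scope.
Local Open Scope classical_set_scope.

(** Let V be the integral closure of R in its total ring of fractions Q and C
    the conductor, which is an ideal of both R and V.  The theorem follows from
    two inclusions: C lies in ca^2 (conductor_sub_ca), and ca^n lies in C for
    every n (ca_sub_conductor).

    Both need V to be a finite R-module (integral_closure_finite).  Fix a
    regular element x of m.  By the length of R / xR the number of generators
    of any ideal containing a regular element is bounded (bounded_generation),
    so by Cayley-Hamilton all elements of V are roots of monic polynomials of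
    one degree e.  If V were not finite, some elements r_k of R divisible by
    x^k in V, chosen by the descending chain condition above xR, would converge
    to a nonzero element of the completion; the equations of degree e give
    r_k^e in x^k R, so this limit would be nilpotent, against reducedness.

    First inclusion.  V is a hereditary ring: a fractional ideal of V that
    contains a unit of Q is invertible (fractional_ideal_invertible), whence
    every submodule of Q^n generated by finitely many vectors over V is
    projective.  In terms of matrices: each matrix A over Q has a generalized
    inverse W such that A W has entries in V (generalized_inverse).  If r is in
    C, then T = r A W is a matrix over R with T A = r A, and T vanishes where A
    does; so multiplication by r on the row space of A factors through a free
    module (conductor_factor).  The first syzygy of a finitely generated module
    is such a row space, and a homotopy shows that r kills Ext^i for i >= 2
    (ext_annihilator_of_factor).

    Second inclusion.  A free resolution of the ideal C, dualized, starts with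
    Hom(C, R), and since R has injective dimension at most 1 the dual complex
    stays exact (gorenstein_dual_exact).  Hence Hom(C, R) is a syzygy of
    arbitrarily high order, and r in ca^n must make multiplication by r on
    Hom(C, R) extend to the free module that contains it (kills_syzygy,
    kills_extension).  As Hom(C, R) is the fractional ideal (R : C), which
    contains V, writing out this extension gives r V in R
    (conductor_of_dual_factor).

    That a finite injective dimension of R is at most 1 is proved in the form
    of Baer's criterion for the cosyzygies, descending from the injective one
    (baer_regular_cosyzygy): the cosyzygies are divisible, and R / m embeds in
    R / xR. *)

(** * Ideals of Noetherian rings *)

Section Ideals.
Variable R : comNzRingType.
Implicit Types (I J B D : set R) (s : seq R).

Definition idl I : Prop :=
  I 0 /\ forall a x y, I x -> I y -> I (a * x + y).

Lemma idealE I : ideal I <-> idl I.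
Proof.
split=> -[].
  rewrite inE => I0 Il; split=> // a x y Ix Iy.
  by have := Il a x y; rewrite !inE; apply.
move=> I0 Il; split; first by rewrite inE.
by move=> a x y; rewrite !inE; apply: Il.
Qed.

Lemma idl0 I : idl I -> I 0. Proof. by case. Qed.

Lemma idlD I x y : idl I -> I x -> I y -> I (x + y).
Proof. by case=> _ Il Ix Iy; have := Il 1 x y Ix Iy; rewrite mul1r. Qed.

Lemma idlM I a x : idl I -> I x -> I (a * x).
Proof. by case=> I0 Il Ix; have := Il a x 0 Ix I0; rewrite addr0. Qed.

Lemma idlMr I a x : idl I -> I x -> I (x * a).
Proof. by rewrite mulrC; exact: idlM. Qed.

Lemma idlN I x : idl I -> I x -> I (- x).
Proof. by move=> hI Ix; rewrite -mulN1r; exact: idlM. Qed.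

Lemma idlB I x y : idl I -> I x -> I y -> I (x - y).
Proof. by move=> hI Ix Iy; apply: idlD => //; exact: idlN. Qed.

Lemma idlDK I x y : idl I -> I y -> I (x + y) -> I x.
Proof. by move=> hI Iy Ixy; rewrite -[x](addrK y); exact: idlB. Qed.

(** The recursion on the list lets the filtration arguments below, where
    generators are added one at a time on top of B, go by induction on s. *)
Fixpoint gen B s : set R :=
  match s with
  | [::] => B
  | a :: s' => [set x | exists c y, gen B s' y /\ x = c * a + y]
  end.

Lemma gen_idl B s : idl B -> idl (gen B s).
Proof.
move=> hB; elim: s => [|b s [s0 sl]] //=; split.
  by exists 0, 0; split=> //; ring.
move=> a x y [c [z [zs ->]]] [d [w [ws ->]]].
by exists (a * c + d), (a * z + w); split; [exact: sl | ring].
Qed.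

Lemma gen_base B s : B `<=` gen B s.
Proof.
elim: s => [|b s IHs] //= x Bx; exists 0, x; split; last by ring.
exact: IHs.
Qed.

Lemma gen_mem B s a : idl B -> a \in s -> gen B s a.
Proof.
move=> hB; elim: s => [|b s IHs] //; rewrite in_cons => /orP[/eqP->|/IHs ga].
  by exists 1, 0; split; [exact: idl0 (gen_idl _ hB) | ring].
by exists 0, a; split => //; ring.
Qed.

Lemma gen_sub B s I :
  idl I -> B `<=` I -> (forall a, a \in s -> I a) -> gen B s `<=` I.
Proof.
move=> hI BI; elim: s => [|b s IHs] //= sI x [c [y [ys ->]]].
have Iy : I y by apply: IHs ys => a ain; apply: sI; rewrite in_cons ain orbT.
by apply: idlD => //; apply: idlM => //; apply: sI; rewrite mem_head.
Qed.

Lemma gen_sum s x :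
  gen [set 0] s x <-> exists c : 'I_(size s) -> R, x = \sum_i c i * s`_i.
Proof.
elim: s x => [|a s IHs] x /=.
  split=> [->|[c ->]]; last by rewrite big_ord0.
  by exists (fun=> 0); rewrite big_ord0.
split=> [[c [y [/IHs[d ->] ->]]]|[c ->]].
  exists (fun i => if unlift ord0 i is Some j then d j else c).
  rewrite big_ord_recl unlift_none; congr (_ + _).
  by apply: eq_bigr => i _; rewrite liftK.
rewrite big_ord_recl; exists (c ord0), (\sum_i c (lift ord0 i) * s`_i).
by split=> //; apply/IHs; exists (fun i => c (lift ord0 i)).
Qed.

Lemma idl_set0 : idl [set (0 : R)].
Proof. by split=> // a x y /= -> ->; ring. Qed.

Definition principal (x : R) : set R := [set y | exists c, y = c * x].

Lemma idl_principal x : idl (principal x).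
Proof.
split=> [|a _ _ [c ->] [d ->]]; first by exists 0; ring.
by exists (a * c + d); ring.
Qed.

Lemma principal_id x : principal x x.
Proof. by exists 1; rewrite mul1r. Qed.

Definition colon I b : set R := [set a | I (a * b)].

Lemma idl_colon I b : idl I -> idl (colon I b).
Proof.
move=> hI; split; rewrite /colon/=; first by rewrite mul0r; exact: idl0.
move=> a x y Ix Iy; rewrite mulrDl -mulrA; exact: hI.2.
Qed.

Definition ann (y : R) : set R := [set z | z * y = 0].
Definition annI I : set R := [set z | forall y, I y -> z * y = 0].

Lemma idl_annI I : idl (annI I).
Proof.
split=> [y _|a u v hu hv y Iy]; first by rewrite mul0r.
by rewrite mulrDl -mulrA hu // hv // mulr0 addr0.
Qed.

Lemma noetherianE : noetherian R <->
  forall I, idl I -> exists s, I = gen [set 0] s.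
Proof.
have spanE (s : seq R^o) : Defs.span s = gen [set 0] s :> set R.
  by apply/predeqP => x; split=> [[c ->]|/gen_sum[c ->]];
    [apply/gen_sum; exists c | exists c].
split=> hN I; first by move=> /idealE/hN[s ->]; exists s; exact: spanE.
by move=> /idealE/hN[s ->]; exists s; rewrite -spanE.
Qed.

(** A strictly increasing sequence of members of Phi would have a finitely
    generated union, hence be stationary. *)
Lemma noetherian_maximal (Phi : set R -> Prop) I0 : noetherian R ->
  (forall I, Phi I -> idl I) -> Phi I0 ->
  exists I, Phi I /\ forall J, Phi J -> I `<=` J -> J `<=` I.
Proof.
move=> /noetherianE hN Pidl P0; apply: contrapT => hmax.
have next (t : {I | Phi I}) : exists u : {I | Phi I},
    sval t `<=` sval u /\ ~ (sval u `<=` sval t).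
  case: t => I PI; apply: contrapT => h; apply: hmax; exists I; split=> // J PJ IJ.
  by apply: contrapT => nJI; apply: h; exists (exist _ J PJ).
have [f hf] := choice next.
pose A n := sval (iter n f (exist _ I0 P0)).
have Ai n : idl (A n) by apply: Pidl; exact: (svalP (iter n f _)).
have Ale n k : A n `<=` A (k + n)%N.
  by elim: k => [|k IHk] // x /IHk; exact: (hf (iter (k + n) f _)).1.
have Amax n k : A n `<=` A (maxn n k) by rewrite maxnE addnC; exact: Ale.
have Uidl : idl [set x | exists n, A n x].
  split=> [|a x y [n nx] [k ky]]; first by exists 0%N; exact: idl0.
  exists (maxn n k); apply: (Ai _).2; first exact: Amax.
  by rewrite maxnC; exact: Amax.
have [s Us] := hN _ Uidl.
have [n hn] : exists n, forall a, a \in s -> A n a.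
  have : forall a, a \in s -> exists n, A n a.
    by move=> a ha; suff : [set x | exists n, A n x] a by []; rewrite Us;
      apply: gen_mem => //; exact: idl_set0.
  elim: (s) => [|a t IHt] ht; first by exists 0%N.
  have [n hn] := IHt (fun b hb => ht b (mem_behead (s := a :: t) hb)).
  have [k hk] := ht a (mem_head a t).
  exists (maxn n k) => b; rewrite in_cons => /orP[/eqP->|/hn].
    by rewrite maxnC; exact: Amax.
  exact: Amax.
apply: (hf (iter n f (exist _ I0 P0))).2; rewrite -[sval (f _)]/(A n.+1) => x Ax.
have : gen [set 0] s x by rewrite -Us; exists n.+1.
apply: gen_sub => //; first exact: Ai.
by move=> y /= ->; exact: idl0 (Ai n).
Qed.

Lemma idl_exp I n : idl (ideal_exp I n).
Proof. by apply/idealE; exact: ideal_ideal_exp. Qed.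

Lemma idl_mul I J : idl (ideal_mul I J).
Proof.
split=> [S [/idealE hS _]|a x y hx hy S hS]; first exact: idl0.
have /idealE hS' := hS.1; apply: hS'.2; [exact: hx | exact: hy].
Qed.

Lemma ideal_mulM I J a b : I a -> J b -> ideal_mul I J (a * b).
Proof. by move=> Ia Jb A [_]; apply; exists a, b. Qed.

Lemma ideal_expX I a n : I a -> ideal_exp I n (a ^+ n).
Proof.
by move=> Ia; elim: n => [|n IHn] //=; rewrite exprS; exact: ideal_mulM.
Qed.

(** I^k I^l = I^(k + l), in the form that the minimality of an ideal product
    gives: the factors of I^k are moved one by one into the colon ideal. *)
Lemma ideal_exp_add I B k l : idl B ->
  (forall a b, ideal_exp I k a -> ideal_exp I l b -> B (a * b)) ->
  ideal_exp I (k + l) `<=` B.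
Proof.
elim: k B => [|k IHk] B hB h; first by move=> b Ib; rewrite -[b]mul1r; exact: h.
move=> z; rewrite addSn => /(_ B); apply; split; first exact/idealE.
move=> _ [u [w [Iu Iw ->]]]; rewrite mulrC.
apply: (IHk (colon B u)) Iw; first exact: idl_colon.
by move=> a b ha hb; rewrite /colon/= mulrC mulrA; apply: h => //; exact: ideal_mulM.
Qed.

Lemma ideal_exp1 I : idl I -> ideal_exp I 1 `<=` I.
Proof.
move=> hI z /(_ I); apply; split; first exact/idealE.
by move=> _ [a [b [Ia _ ->]]]; rewrite mulrC; exact: idlM.
Qed.

(** Otherwise let B' be maximal among the ideals above B that contain no power
    of I.  Some z in I is outside B' while z^2 is in B'; then a power of I lies
    in B' + Rz, and its square lies in B'. *)
Lemma ideal_exp_nilpotent I B : noetherian R -> idl I -> idl B ->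
  (forall a, I a -> exists k, B (a ^+ k)) -> exists k, ideal_exp I k `<=` B.
Proof.
move=> hN hI hB hnil; apply: contrapT => hno.
have [B' [[B'i BB' B'no] B'max]] := @noetherian_maximal
  (fun J => [/\ idl J, B `<=` J & forall k, ~ (ideal_exp I k `<=` J)]) B hN
  (fun J h => let: And3 h _ _ := h in h)
  (And3 hB (fun _ h => h) (fun k h => hno (ex_intro _ k h))).
have [y [Iy ny]] : exists y, I y /\ ~ B' y.
  apply: contrapT => h; apply: (B'no 1%N) => y /(ideal_exp1 hI) Iy.
  by apply: contrapT => ny; apply: h; exists y.
have [j nj jS] : exists2 j, ~ B' (y ^+ j.+1) & B' (y ^+ j.+2).
  have [k Bk] := hnil y Iy; apply: contrapT => h; apply: ny.
  have : B' (y ^+ k.+1) by rewrite exprS; apply: idlM => //; exact: BB'.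
  elim: k {Bk} => [|k IHk]; first by rewrite expr1.
  by move=> hk; apply: IHk; apply: contrapT => nk; apply: h; exists k.
set z := y ^+ j.+1 in nj.
have Bz2 : B' (z * z).
  have -> : z * z = y ^+ j * y ^+ j.+2 by rewrite /z !exprS; ring.
  exact: idlM.
have Ci : idl (gen B' [:: z]) by exact: gen_idl.
have [k hk] : exists k, ideal_exp I k `<=` gen B' [:: z].
  apply: contrapT => h; apply: nj; apply: (B'max (gen B' [:: z])).
  - split=> // [b Bb|k hk]; first by apply: gen_base; exact: BB'.
    by apply: h; exists k.
  - exact: gen_base.
  - by apply: gen_mem => //; rewrite mem_head.
apply: (B'no (k + k)%N); apply: ideal_exp_add => // a b.
move=> /hk[c [a' [/= Ba' ->]]] /hk[d [b' [/= Bb' ->]]].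
have -> : (c * z + a') * (d * z + b') =
  (c * d) * (z * z) + ((c * z) * b' + (d * z + b') * a') by ring.
by apply: B'i.2 => //; apply: B'i.2 => //; exact: idlM.
Qed.

End Ideals.

(** * Noetherian local rings *)

Section Local.
Variables (R : comNzRingType) (m : set R).
Hypotheses (noethR : noetherian R) (localR : local_ring m).
Implicit Types (I J B D A : set R) (s : seq R).

Lemma idealr_closedE I : idealr_closed [in I] <-> idl I /\ ~ I 1.
Proof.
split.
  case; rewrite inE => I0 /negP I1 Il; split=> //; last by rewrite inE in I1.
  by split=> // a x y Ix Iy; have := Il a x y; rewrite !inE; apply.
case=> -[I0 Il] I1; split; first by rewrite inE.
  by apply/negP; rewrite inE.
by move=> a x y; rewrite !inE; exact: Il.
Qed.

Lemma m_idl : idl m. Proof. by case: localR => -[/idealr_closedE[]]. Qed.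

Lemma m_not1 : ~ m 1. Proof. by case: localR => -[/idealr_closedE[]]. Qed.

(** The maximal ideal above I is m, the only one. *)
Lemma proper_sub_m I : idl I -> ~ I 1 -> I `<=` m.
Proof.
move=> hI I1.
have [M [[[Mi M1] IM] Mmax]] := @noetherian_maximal R
  (fun J => (idl J /\ ~ J 1) /\ I `<=` J) I noethR
  (fun J h => h.1.1) (conj (conj hI I1) (fun _ h => h)).
suff <- : M = m by [].
apply: localR.2; split; first exact/idealr_closedE.
move=> J /idealr_closedE[Ji J1] MJ; rewrite eqEsubset; split=> //.
by apply: Mmax => //; split=> // x /IM /MJ.
Qed.

Lemma unit_of_notin_m a : ~ m a -> exists b, b * a = 1.
Proof.
move=> ma; apply: contrapT => h; apply: ma.
apply: (proper_sub_m (idl_principal a)); last exact: principal_id.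
by case=> c e; apply: h; exists c.
Qed.

Lemma unit_1B a : m a -> exists b, b * (1 - a) = 1.
Proof.
move=> ma; apply: unit_of_notin_m => m1a; apply: m_not1.
by rewrite -[1](subrK a); apply: idlD => //; exact: m_idl.
Qed.

Lemma idl_unit I a b c : idl I -> b * a = 1 -> I (a * c) -> I c.
Proof. by move=> hI e Iac; rewrite -[c]mul1r -e -mulrA; exact: idlM. Qed.

(** If A' is maximal among the ideals above A that
    do not contain I, and b is in I but not in A', then I lies in A' + Rb, so b
    lies in A' + mb, and 1 - m consists of units. *)
Lemma nakayama A I : idl A -> idl I ->
  (forall x, I x -> exists a y, [/\ A a, ideal_mul m I y & x = a + y]) ->
  I `<=` A.
Proof.
move=> hA hI h; apply: contrapT => nIA.
have [A' [[A'i AA' nIA'] A'max]] := @noetherian_maximal R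
  (fun J => [/\ idl J, A `<=` J & ~ (I `<=` J)]) A noethR
  (fun J h => let: And3 h _ _ := h in h) (And3 hA (fun _ h => h) nIA).
have [b [Ib nb]] : exists b, I b /\ ~ A' b.
  by apply: contrapT => h'; apply: nIA' => b Ib; apply: contrapT => nb; apply: h'; exists b.
have Ii : idl (gen A' [:: b]) by exact: gen_idl.
have IA' : I `<=` gen A' [:: b].
  apply: contrapT => h'; apply: nb; apply: (A'max (gen A' [:: b])).
  - by split=> // a Aa; apply: gen_base; exact: AA'.
  - exact: gen_base.
  - by apply: gen_mem => //; rewrite mem_head.
have [a [y [Aa mIy e]]] := h b Ib.
have [mu [a' [mmu Aa' e']]] : exists mu a', [/\ m mu, A' a' & y = mu * b + a'].
  apply: (mIy [set y | exists mu a', [/\ m mu, A' a' & y = mu * b + a']]); split.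
    apply/idealE; split.
      by exists 0, 0; split; [exact: idl0 m_idl | exact: idl0 | ring].
    move=> c _ _ [u [v [mu Av ->]]] [u' [v' [mu' Av' ->]]].
    by exists (c * u + u'), (c * v + v'); split; [apply: m_idl.2 | apply: A'i.2 | ring].
  move=> _ [u [v [mu /IA' [c [w [Aw ->]]] ->]]].
  by exists (c * u), (u * w); split; [apply: idlM m_idl _ | apply: idlM | ring].
have [c hc] := unit_1B mmu.
apply: nb; apply: (idl_unit A'i hc); have -> : (1 - mu) * b = a + a'.
  by rewrite mulrBl mul1r {1}e e'; ring.
by apply: idlD => //; exact: AA'.
Qed.

(** Let D be the intersection and B maximal with B and D meeting in mD.  For y
    in m the chain B : y^k is stationary, which gives y^k in B for some k.  So
    B contains a power of m, hence D, and D = mD. *)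
Lemma krull_intersection x : (forall k, ideal_exp m k x) -> x = 0.
Proof.
move: x; pose D := [set x | forall k, ideal_exp m k x].
have hD : idl D.
  split=> [k|a x y Dx Dy k]; first exact: idl0 (idl_exp m k).
  by apply: (idl_exp m k).2; [exact: Dx | exact: Dy].
have mDi : idl (ideal_mul m D) by exact: idl_mul.
have mDD : ideal_mul m D `<=` D.
  move=> x mDx; apply: (mDx D); split; first exact/idealE.
  by move=> _ [a [b [_ Db ->]]]; exact: (idlM a hD Db).
have [B [[Bi BD] Bmax]] := @noetherian_maximal R
  (fun J => idl J /\ J `&` D = ideal_mul m D) (ideal_mul m D) noethR
  (fun J h => h.1) (conj mDi (classical_sets.setIidl mDD)).
have mDB : ideal_mul m D `<=` B by rewrite -BD => z [].
have nil y : m y -> exists k, B (y ^+ k).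
  move=> my.
  have [I [[k Ik] Imax]] := @noetherian_maximal R
    (fun J => exists k, J = colon B (y ^+ k)) _ noethR
    ltac:(by move=> J [k ->]; exact: idl_colon) (ex_intro _ 0%N erefl).
  have hk a : B (a * y ^+ k.+1) -> B (a * y ^+ k).
    move=> Ba; rewrite -[B _]/(colon B (y ^+ k) a) -Ik.
    apply: (Imax (colon B (y ^+ k.+1))) => //; first by exists k.+1.
    by rewrite Ik => b; rewrite /colon/= exprS mulrCA => Bb; exact: idlM.
  exists k; have Ci : idl (gen B [:: y ^+ k]) by exact: gen_idl.
  apply: (Bmax (gen B [:: y ^+ k])); last 1 first.
  - by apply: gen_mem => //; rewrite mem_head.
  - split=> //; rewrite eqEsubset; split=> z; last first.
      move=> mDz; split; last exact: mDD.
      by apply: gen_base; exact: mDB.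
    case=> -[c [b [/= Bb ez]]] Dz; rewrite -BD; split=> //.
    rewrite ez; apply: idlD => //; apply: hk.
    have : B (y * z) by apply: mDB; exact: ideal_mulM.
    rewrite ez mulrDr => h; have := idlDK Bi (idlM y Bi Bb) h.
    by rewrite exprS mulrCA.
  - exact: gen_base.
have [k hk] := ideal_exp_nilpotent noethR m_idl Bi nil.
have sub0 : D `<=` [set 0].
  apply: nakayama => // [|x Dx]; first exact: idl_set0.
  exists 0, x; split=> //; last by rewrite add0r.
  by rewrite -BD; split=> //; apply: hk; exact: Dx.
by move=> x /sub0.
Qed.

End Local.

(** * Regular elements in reduced Noetherian rings *)

Section Reduced.
Variable R : comNzRingType.
Hypotheses (noethR : noetherian R) (redR : reduced R).
Implicit Types (I J : set R).

Lemma lreg_annP (x : R) : GRing.lreg x <-> forall z, z * x = 0 -> z = 0.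
Proof.
split=> [h z zx|h a b e]; first by apply: h; rewrite mulr0 mulrC.
by apply/eqP; rewrite -subr_eq0; apply/eqP/h; rewrite mulrBl mulrC e mulrC subrr.
Qed.

Lemma sq_eq0 (x : R) : x * x = 0 -> x = 0.
Proof. by rewrite -expr2; exact: redR. Qed.

(** Choose t in I with minimal annihilator.  If z t = 0 but z y <> 0 with y in
    I, then t + z y has a strictly smaller annihilator because R is reduced. *)
Lemma ann_minimal I : idl I -> exists2 t, I t & ann t `<=` annI I.
Proof.
move=> hI.
have [J [[t It ->] Jmax]] := @noetherian_maximal R
  (fun J => exists2 t, I t & J = annI (ann t)) (annI (ann 0)) noethR
  ltac:(by move=> J [t _ ->]; exact: idl_annI) (ex_intro2 _ _ 0 (idl0 hI) erefl).
exists t => // z zt y Iy; apply: sq_eq0.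
have It' : I (t + z * y) by apply: idlD => //; exact: idlM.
have sub : annI (ann t) `<=` annI (ann (t + z * y)).
  move=> w hw v hv; apply: hw; rewrite /ann/= in hv zt *.
  have vzy : v * (z * y) = 0.
    apply: sq_eq0; have -> : v * (z * y) * (v * (z * y)) =
      v * (t + z * y) * (v * z * y) - v * v * y * (z * t) by ring.
    by rewrite hv zt; ring.
  by move: hv; rewrite mulrDr vzy addr0.
have := Jmax _ (ex_intro2 _ _ _ It' erefl) sub (t + z * y).
move=> /(_ _ z zt) h.
have : (t + z * y) * z = 0 by apply: h => v; rewrite /ann/= mulrC.
by rewrite mulrDl [t * z]mulrC zt add0r => e; rewrite -[RHS](mul0r y) -e; ring.
Qed.

(** A substitute for splitting the product of fields Q into the part that
    supports I and its complement: t is a unit on the former and s on the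
    latter. *)
Lemma regular_split I : idl I ->
  exists t s, [/\ I t, annI I s & GRing.lreg (t + s)].
Proof.
move=> hI; have [t It ht] := ann_minimal hI.
have [s Is hs] := ann_minimal (idl_annI I).
exists t, s; split=> //; apply/lreg_annP => z e.
have st : s * t = 0 by exact: Is.
have zt : z * t = 0.
  apply: sq_eq0; have -> : z * t * (z * t) = z * (t + s) * (z * t) - z * z * (s * t) by ring.
  by rewrite e st; ring.
have zs : z * s = 0 by move: e; rewrite mulrDr zt add0r.
exact/sq_eq0/(hs z zs)/(ht z zt).
Qed.

End Reduced.

(** * One-dimensional local rings: finite length modulo a regular element *)

Section DimOne.
Variables (R : comNzRingType) (m : set R).
Hypotheses (noethR : noetherian R) (localR : local_ring m).
Hypotheses (redR : reduced R) (dimR : krull_dim R 1).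
Implicit Types (I J : set R) (s : seq R).

Let mi := m_idl localR.

(** An ideal maximal among those that avoid a multiplicative set is prime. *)
Lemma prime_ideal_ex (S I0 : set R) : S 1 ->
  (forall a b, S a -> S b -> S (a * b)) -> idl I0 ->
  (forall a, I0 a -> ~ S a) ->
  exists P, [/\ prime_ideal P, I0 `<=` P & forall a, P a -> ~ S a].
Proof.
move=> S1 SM hI0 h0.
have [P [[Pi I0P PS] Pmax]] := @noetherian_maximal R
  (fun J => [/\ idl J, I0 `<=` J & forall a, J a -> ~ S a]) I0 noethR
  (fun J h => let: And3 h _ _ := h in h) (And3 hI0 (fun _ h => h) h0).
exists P; split=> //; split.
  by apply/idealr_closedE; split=> // P1; exact: PS P1 S1.
have meets u : ~ P u -> exists a c, [/\ P a & S (c * u + a)].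
  move=> nu; apply: contrapT => h; apply: nu; apply: (Pmax (gen P [:: u])).
  - split; [exact: gen_idl | by move=> b /I0P Pb; exact: gen_base |].
    by move=> _ [c [a [/= Pa ->]]] Sa; apply: h; exists a, c.
  - exact: gen_base.
  - by apply: gen_mem => //; rewrite mem_head.
move=> u v; rewrite inE => Puv; apply: contrapT => /negP; rewrite negb_or.
move=> /andP[/negP]; rewrite inE => /meets[a [c [Pa Sa]]].
move=> /negP; rewrite inE => /meets[b [d [Pb Sb]]].
apply: PS (SM _ _ Sa Sb).
have -> : (c * u + a) * (d * v + b) =
  (c * d) * (u * v) + ((c * u) * b + (d * v + b) * a) by ring.
by apply: Pi.2 => //; apply: Pi.2 => //; exact: idlM.
Qed.

Lemma prime_idealE (P : set R) : prime_ideal P ->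
  [/\ idl P, ~ P 1 & forall u v, P (u * v) -> P u \/ P v].
Proof.
move=> [/idealr_closedE[Pi P1] Pp]; split=> // u v Puv.
by have := Pp u v; rewrite !inE => /(_ Puv)/orP[]; rewrite inE; [left|right].
Qed.

Lemma prime_ideal_m : prime_ideal m.
Proof.
split; first by apply/idealr_closedE; split=> //; exact: m_not1 localR.
move=> u v; rewrite inE => muv; apply: contrapT => /negP; rewrite negb_or.
move=> /andP[/negP]; rewrite inE => /(unit_of_notin_m noethR localR)[c hc].
by move=> /negP; rewrite inE; apply; exact: idl_unit hc muv.
Qed.

(** If the element t of m with minimal annihilator is a zero divisor, m is
    annihilated by a nonzero element; since R is reduced, that element is a
    unit and R is a field, of dimension 0. *)
Lemma regular_in_m : exists2 x, m x & GRing.lreg x.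
Proof.
have [t mt ht] := ann_minimal noethR redR mi.
exists t => //; apply/lreg_annP => z /ht hz.
have [mz|nz] := pselect (m z); first exact/(sq_eq0 redR)/hz.
have [c hc] := unit_of_notin_m noethR localR nz.
have m0 y : m y -> y = 0 by move=> my; rewrite -[y]mul1r -hc -mulrA hz // mulr0.
have [[p [pp pl]] _] := dimR.
have [] := pl 0%N isT => _ []; move=> a pa.
have [[p0 _ _] [p1 p11 _]] := (prime_idealE (pp 0%N isT), prime_idealE (pp 1%N isT)).
by rewrite (m0 a); [exact: idl0 p0 | exact: (proper_sub_m noethR localR p1 p11)].
Qed.

(** Otherwise there is a prime P containing x but not y, and inside P a prime
    avoiding all products of a power of x with an element outside P.  With m
    they form a chain of length 2. *)
Lemma nilpotent_mod_regular x y :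
  GRing.lreg x -> m y -> exists k, principal x (y ^+ k).
Proof.
move=> xreg my; apply: contrapT => hno.
have [P [Pp xP Py]] := @prime_ideal_ex [set a | exists k, a = y ^+ k] (principal x)
  (ex_intro _ 0%N erefl)
  ltac:(by move=> _ _ [k ->] [l ->]; exists (k + l)%N; rewrite exprD)
  (idl_principal x) ltac:(by move=> a xa [k e]; apply: hno; exists k; rewrite -e).
have [Pi P1 PM] := prime_idealE Pp.
have [P0 [P0p _ P0S]] := @prime_ideal_ex
  [set a | exists k t, ~ P t /\ a = x ^+ k * t] [set 0]
  ltac:(by exists 0%N, 1; split=> //; rewrite mulr1)
  ltac:(by move=> _ _ [k [t [Pt ->]]] [l [u [Pu ->]]]; exists (k + l)%N, (t * u);
    split; [move=> /PM[] | rewrite exprD; ring])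
  (@idl_set0 R)
  ltac:(by move=> _ /= -> [k [t [Pt e]]]; apply: Pt;
    rewrite (_ : t = 0); [exact: idl0 Pi | by apply: (@lregX _ x k xreg); rewrite mulr0 -e]).
have [P0i _ _] := prime_idealE P0p.
have [_ nch] := dimR; apply: nch.
(* x lies in P but not in P0, and y in m but not in P. *)
exists (fun i => match i with 0 => P0 | 1 => P | _ => m end)%N; split.
  by move=> [|[|[|i]]] // _; exact: prime_ideal_m.
move=> [|[|i]] // _; split.
- move=> a P0a; apply: contrapT => nPa; apply: (P0S a P0a).
  by exists 0%N, a; rewrite mul1r.
- move=> /(_ x (xP _ (principal_id x))) P0x; apply: (P0S x P0x).
  by exists 1%N, 1; rewrite mulr1.
- exact: (proper_sub_m noethR localR Pi P1).
- by move=> /(_ y my) Pny; apply: (Py y Pny); exists 1%N.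
Qed.

Lemma exp_m_sub_regular x : GRing.lreg x ->
  exists k, ideal_exp m k `<=` principal x.
Proof.
move=> xreg; apply: ideal_exp_nilpotent => //; first exact: idl_principal.
by move=> a ma; exact: nilpotent_mod_regular.
Qed.

(** R / I is Artinian, so it has a simple submodule.  Concretely, take b with
    maximal colon ideal I : b; replacing b by u^j b, where j is the last
    exponent with u^j b outside I, does not change I : b. *)
Lemma socle x I : GRing.lreg x -> idl I -> I x -> ~ I 1 ->
  exists2 b, ~ I b & forall u, m u -> I (u * b).
Proof.
move=> xreg hI Ix I1.
have [J [[b nb ->] Jmax]] := @noetherian_maximal R
  (fun J => exists2 b, ~ I b & J = colon I b) (colon I 1) noethR
  ltac:(by move=> J [b _ ->]; exact: idl_colon) (ex_intro2 _ _ 1 I1 erefl).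
exists b => // u mu; rewrite -[I _]/(colon I b u).
have [j nj jS] : exists2 j, ~ I (u ^+ j * b) & I (u ^+ j.+1 * b).
  have [k [c hk]] := nilpotent_mod_regular xreg mu.
  have : I (u ^+ k * b) by rewrite hk mulrAC; exact: idlM.
  elim: k {c hk} => [|k IHk]; first by rewrite mul1r.
  have [/IHk//|nk hk] := pselect (I (u ^+ k * b)); by exists k.
apply: (Jmax (colon I (u ^+ j * b))); first by exists (u ^+ j * b).
  by move=> a; rewrite /colon/= mulrCA; exact: idlM.
by rewrite /colon/= mulrA -exprS.
Qed.

(** The ideals generated over xR by the tails of s have successive quotients
    that are 0 or R / m.  If they reach R, the length of R / xR is at most
    size s. *)
Fixpoint comp_series x s : Prop :=
  match s with
  | [::] => True
  | a :: s' => (forall u, m u -> gen (principal x) s' (u * a)) /\ comp_series x s'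
  end.

(** A maximal ideal that such a list generates over xR is R, since a socle
    element of the quotient could be put in front of the list. *)
Lemma comp_series_ex x : GRing.lreg x ->
  exists2 s, comp_series x s & gen (principal x) s 1.
Proof.
move=> xreg.
have [I [[s cs ->] Imax]] := @noetherian_maximal R
  (fun J => exists2 s, comp_series x s & J = gen (principal x) s) (principal x) noethR
  ltac:(by move=> J [s _ ->]; apply: gen_idl; exact: idl_principal)
  (ex_intro2 _ _ [::] I erefl).
have gi t : idl (gen (principal x) t) by apply: gen_idl; exact: idl_principal.
exists s => //; apply: contrapT => n1.
have [b nb hb] := socle xreg (gi s) (gen_base s (principal_id x)) n1.
apply: nb; apply: (Imax (gen (principal x) (b :: s))); first by exists (b :: s).
  by move=> a ga; exists 0, a; split=> //; ring.
by apply: gen_mem; [exact: idl_principal | rewrite mem_head].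
Qed.

(** Induction along the filtration of R / xR: if the chain A_n + Rb is
    stationary, then so is A_n, because b lies in all A_n or, from some point
    on, only its multiples by m do. *)
Lemma dcc x (A : nat -> set R) : GRing.lreg x ->
  (forall n, idl (A n)) -> (forall n, A n.+1 `<=` A n) ->
  (forall n, A n x) -> exists n, forall k, A n `<=` A (n + k)%N.
Proof.
move=> xreg Ai Ad Ax; have [s cs gs] := comp_series_ex xreg.
pose stable (L : set R) := forall A : nat -> set R,
  (forall n, idl (A n)) -> (forall n, A n.+1 `<=` A n) ->
  (forall n, L `<=` A n) -> exists n, forall k, A n `<=` A (n + k)%N.
have desc (B : nat -> set R) : (forall n, B n.+1 `<=` B n) ->
    forall n k, B (n + k)%N `<=` B n.
  move=> Bd n; elim=> [|k IHk]; first by rewrite addn0.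
  by rewrite addnS => a /Bd; exact: IHk.
suff : stable (gen (principal x) [::]).
  by apply=> // n a [c ->]; exact: idlM (Ai n) (Ax n).
have : stable (gen (principal x) s).
  move=> B Bi Bd Bs; exists 0%N => k a _.
  by rewrite -[a]mulr1; apply: idlM => //; exact: Bs.
elim: s cs {gs} => [|b s IHs] //= [bs cs] st; apply: IHs => // B Bi Bd sB.
have [|//|n a [c [y [gy ->]]]|n0 hn0] := st (fun n => gen (B n) [:: b]).
- by move=> n; exact: gen_idl.
- by move=> n a [c [y [/= /Bd By ->]]]; exists c, y.
- by exists c, y; split=> //; exact: sB.
have [allb|nallb] := pselect (forall n, B n b).
  exists n0 => k a Ba; have [|c [y [/= By ->]]] := hn0 k a; first exact: gen_base.
  by apply: idlD => //; exact: idlM.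
have [n1 nb] : exists n1, ~ B n1 b.
  by apply: contrapT => h; apply: nallb => n; apply: contrapT => nb; apply: h; exists n.
exists (n0 + n1)%N => k a Ba.
have [|c [y [/= By ea]]] := hn0 (n1 + k)%N a.
  by apply: gen_base; exact: desc Ba.
rewrite addnA in By; have Bcb : B (n0 + n1)%N (c * b).
  apply: (idlDK (Bi _) _ (_ : B _ (c * b + y))); first exact: desc By.
  by rewrite -ea.
have [mc|nc] := pselect (m c).
  by rewrite ea; apply: idlD => //; apply: sB; exact: bs.
have [d hd] := unit_of_notin_m noethR localR nc.
case: nb; have := idl_unit (Bi _) hd Bcb.
by rewrite addnC; exact: desc.
Qed.

(** Leading forms for the x-adic filtration refined by s.  For each entry a of
    s, the leading term x^k a with the least k that occurs in I is taken from
    one element of I; its multiples by x cancel all leading terms x^k' a with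
    larger exponents.  So one generator per entry of s suffices, up to higher
    powers of x. *)
Lemma gen_graded x s I : comp_series x s -> idl I ->
  exists2 g : seq R, size g = size s /\ (forall a, a \in g -> I a) &
    forall k l, gen (principal x) s l -> I (x ^+ k * l) ->
      exists2 h, gen [set 0] g h & exists c, x ^+ k * l = h + x ^+ k.+1 * c.
Proof.
move=> + hI; elim: s => [|a s IHs] /=.
  move=> _; exists [::] => // k l [c ->] _; exists 0 => //.
  by exists c; rewrite exprS; ring.
move=> [as_ /IHs[g [sg gI] hg]].
pose bad k := exists l, [/\ gen (principal x) (a :: s) l, I (x ^+ k * l) &
  ~ exists2 l', gen (principal x) s l' & x ^+ k * l = x ^+ k * l'].
have gi t : idl (gen (principal x) t) by apply: gen_idl; exact: idl_principal.
(* The exponents k at which a occurs in a leading term x^k a of I. *)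
have [[k0 bk0]|nobad] := pselect (exists k, bad k); last first.
  exists (0 :: g).
    by split; [rewrite /= sg | move=> b; rewrite in_cons => /orP[/eqP->|/gI//]; exact: idl0].
  move=> k l gl Il; have [[l' gl' e]|nl] :=
    pselect (exists2 l', gen (principal x) s l' & x ^+ k * l = x ^+ k * l').
    rewrite e in Il *; have [h gh hc] := hg k l' gl' Il; exists h => //.
    by exists 0, h; split=> //; ring.
  by case: nobad; exists k, l.
have {bk0 k0} [k0 [/asboolP[l0 [[c0 [y0 [gy0 ->]]] Il0 nl0]] k0min]] :
    exists k0, `[< bad k0 >] /\ forall k, bad k -> (k0 <= k)%N.
  have ex : exists k, `[< bad k >] by exists k0; exact/asboolP.
  by exists (ex_minn ex); case: ex_minnP => k bk kmin; split=> // j /asboolP; exact: kmin.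
set g0 := x ^+ k0 * (c0 * a + y0).
(* A coefficient c0 in m would push c0 a down to the next step of the filtration. *)
have [b0 hb0] : exists b, b * c0 = 1.
  apply: (unit_of_notin_m noethR localR) => mc0; apply: nl0.
  exists (c0 * a + y0) => //; apply: idlD => //; exact: as_.
exists (g0 :: g).
  by split; [rewrite /= sg | move=> b; rewrite in_cons => /orP[/eqP->|/gI//]].
move=> k l gl Il; have [[l' gl' e]|nl] :=
    pselect (exists2 l', gen (principal x) s l' & x ^+ k * l = x ^+ k * l').
  rewrite e in Il *; have [h gh hc] := hg k l' gl' Il; exists h => //.
  by exists 0, h; split=> //; ring.
have le : (k0 <= k)%N by apply: k0min; exists l.
case: gl nl Il => c [y [gy ->]] nl Il.
have e : x ^+ k * (c * a + y) - c * b0 * x ^+ (k - k0) * g0 =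
    x ^+ k * (y - c * b0 * y0).
  rewrite -{1 3}(subnK le) exprD /g0.
  have -> : x ^+ (k - k0) * x ^+ k0 * (c * a + y) -
    c * b0 * x ^+ (k - k0) * (x ^+ k0 * (c0 * a + y0)) =
    x ^+ (k - k0) * x ^+ k0 * (y - c * b0 * y0 + c * a * (1 - b0 * c0)) by ring.
  by rewrite hb0; ring.
have [|h gh [d hd]] := hg k (y - c * b0 * y0) (idlB (gi s) gy (idlM _ (gi s) gy0)).
  by rewrite -e; apply: idlB => //; exact: idlM.
exists (c * b0 * x ^+ (k - k0) * g0 + h).
  by exists (c * b0 * x ^+ (k - k0)), h.
by exists d; rewrite -addrA -hd -e; ring.
Qed.

(** The bound is the length of R / xR for a regular x in m.  An ideal I that
    contains a regular element contains a power of x, so that approximating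
    modulo a high power of x is approximating modulo mI. *)
Lemma bounded_generation : exists e : nat, forall I y, idl I -> I y -> GRing.lreg y ->
  exists2 g : seq R, size g = e & I = gen [set 0] g.
Proof.
have [x mx xreg] := regular_in_m.
have [s cs gs] := comp_series_ex xreg.
exists (size s) => I y hI Iy yreg.
have [g [sg gI] hg] := gen_graded cs hI.
have gi : idl (gen [set 0] g) by apply: gen_idl; exact: idl_set0.
have subI : gen [set 0] g `<=` I.
  by apply: gen_sub => // _ ->; exact: idl0.
exists g => //; rewrite eqEsubset; split=> //.
have step k f : I f -> exists h c, gen [set 0] g h /\ f = h + x ^+ k * c.
  move=> If; elim: k => [|k [h [c [gh e]]]]; first by exists 0, f; split; [exact: idl0 gi | ring].
  have [||h' gh' [c' e']] := hg k c.
  - rewrite -[c]mulr1; apply: idlM gs; apply: gen_idl; exact: idl_principal.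
  - have -> : x ^+ k * c = f - h by rewrite e; ring.
    by apply: idlB => //; exact: subI.
  - by exists (h + h'), c'; split; [exact: idlD | rewrite e e'; ring].
have [k [d hd]] := nilpotent_mod_regular yreg mx.
apply: (nakayama noethR localR gi hI) => f If.
have [h [c [gh e]]] := step k.+1 f If.
exists h, (x ^+ k.+1 * c); split=> //.
have -> : x ^+ k.+1 * c = x * (c * d * y) by rewrite exprS hd; ring.
by apply: ideal_mulM => //; exact: idlM.
Qed.

End DimOne.

(** * The completion *)

Section Completion.
Variables (R : comNzRingType) (m : idealr R).
Hypothesis red : reduced (completion m).

(** Reducedness of the completion, read on sequences: rho represents an element
    whose e-th power vanishes. *)
Lemma coherent_nilpotent (rho : nat -> R) e :
  (forall n, ideal_exp [set` m] n (rho n.+1 - rho n)) ->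
  (forall n, ideal_exp [set` m] n (rho n ^+ e)) ->
  forall n, ideal_exp [set` m] n (rho n).
Proof.
move=> coh nul.
have cP : rho \in coherent m by apply/asboolP.
pose z := CoherentSeq cP.
have zX n k : coherent_val (z ^+ k) n = rho n ^+ k.
  by elim: k => [|k IHk] //; rewrite !exprS -IHk.
have piE (w : coherent_seq m) :
    (\pi_(completion m) w = 0) <-> (w \in @null_seq R m).
  have -> : (0 : completion m) = \pi_(completion m) 0 by rewrite (raddf0 \pi_(completion m)).
  split=> [/eqP|h]; last apply/eqP; by rewrite -Quotient.idealrBE subr0.
have : (\pi_(completion m) z) ^+ e = 0.
  rewrite -rmorphXn; apply/piE/asboolP => n; rewrite zX; exact: nul.
by move=> /red/piE/asboolP h n; exact: h.
Qed.

(** R embeds in its completion by Krull's intersection theorem. *)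
Lemma reduced_of_completion : noetherian R -> local_ring [set` m] -> reduced R.
Proof.
move=> hN hl x e xe; apply: (krull_intersection hN hl).
apply: (coherent_nilpotent (rho := fun=> x) (e := e)) => n.
  by rewrite subrr; exact: idl0 (idl_exp _ _).
by rewrite xe; exact: idl0 (idl_exp _ _).
Qed.
End Completion.

(** * Integral elements of the total ring of fractions *)

Section IntegralClosure.
Variable R : comNzRingType.
Local Notation Q := (total_fractions R).
Local Notation io := (@tf_embed R).
Local Notation V := (@integral_closure R).
Implicit Types (v w z : Q) (r s : R).

Lemma icM v w : V v -> V w -> V (v * w). Proof. exact: integral_mul. Qed.
Lemma icD v w : V v -> V w -> V (v + w). Proof. exact: integral_add. Qed.
Lemma icB v w : V v -> V w -> V (v - w). Proof. exact: integral_sub. Qed.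
Lemma ic_tf r : V (io r). Proof. exact: integral_id. Qed.
Lemma ic0 : V 0. Proof. exact: integral0. Qed.
Lemma ic1 : V 1. Proof. exact: integral1. Qed.
Lemma icX v k : V v -> V (v ^+ k).
Proof. by move=> Vv; elim: k => [|k IHk]; [exact: ic1 | rewrite exprS; exact: icM]. Qed.
Lemma ic_sum n (f : 'I_n -> Q) : (forall i, V (f i)) -> V (\sum_i f i).
Proof. by move=> h; apply: (big_ind V) => //; [exact: ic0 | exact: icD]. Qed.

Lemma tf_cancel s z : GRing.lreg s -> io s * z = 0 -> z = 0.
Proof.
move=> /tf_embed_unit[q sq] e.
by rewrite -[z]mul1r -sq mulrAC e mul0r.
Qed.

Lemma tf_lcancel s z w : GRing.lreg s -> io s * z = io s * w -> z = w.
Proof.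
move=> sreg e; apply/eqP; rewrite -subr_eq0; apply/eqP/(tf_cancel sreg).
by rewrite mulrBr e subrr.
Qed.

Lemma lreg_tf_unit s z : io s * z = 1 -> GRing.lreg s.
Proof.
move=> e; apply/lreg_annP => a as0; apply: tf_embed_inj.
by rewrite rmorph0 -[LHS]mulr1 -e mulrA -rmorphM as0 rmorph0 mul0r.
Qed.

Lemma monic_root_expand (p : {poly R}) d v :
  p \is monic -> size p = d.+1 -> root (map_poly io p) v ->
  v ^+ d = - \sum_(j < d) io p`_j * v ^+ j.
Proof.
move=> pm sp /rootP; rewrite horner_coef size_map_poly_id0; last first.
  by rewrite (monicP pm) rmorph1 oner_neq0.
have pd : p`_d = 1 by rewrite -(monicP pm) /lead_coef sp.
have -> : size p = d.+1 by [].
rewrite big_ord_recr /= (_ : (map_poly io p)`_d = 1); last first.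
  by rewrite coef_map pd; exact: (rmorph1 io).
rewrite mul1r => /eqP.
rewrite addrC addr_eq0 => /eqP ->; congr (- _).
by apply: eq_bigr => i _; rewrite coef_map.
Qed.

(** Cayley-Hamilton: v is a root of the characteristic polynomial of any matrix
    of the multiplication by v on the generators.  Its degree is the number of
    generators. *)
Lemma determinant_trick v (g : seq R) y :
  (forall a, gen [set 0] g a -> exists2 b, gen [set 0] g b & v * io a = io b) ->
  gen [set 0] g y -> GRing.lreg y ->
  exists p : {poly R}, [/\ p \is monic, size p = (size g).+1 & root (map_poly io p) v].
Proof.
move=> stab gy yreg; set e := size g.
have : forall i : 'I_e, exists c : 'I_e -> R, v * io g`_i = \sum_j io (c j) * io g`_j.
  move=> i; have [|b /gen_sum[c bE] ->] := stab g`_i.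
    by apply: gen_mem; [exact: idl_set0 | exact: mem_nth].
  by exists c; rewrite bE rmorph_sum; apply: eq_bigr => j _; rewrite rmorphM.
move=> /choice[T hT]; pose A : 'M[R]_e := \matrix_(i, j) T i j.
exists (char_poly A); split; [exact: char_poly_monic | exact: size_char_poly |].
apply/rootP; rewrite map_char_poly.
pose B : 'M[Q]_e := v%:M - map_mx io A.
have -> : (char_poly (map_mx io A)).[v] = \det B.
  rewrite -[LHS]/(horner_eval v _) /char_poly /char_poly_mx -det_map_mx; congr (\det _).
  apply/matrixP => i j; rewrite !mxE /= /horner_eval hornerD hornerN hornerC.
  by case: (i == j); rewrite ?mulr1n ?mulr0n ?hornerX ?hornerC.
pose G : 'cV[Q]_e := \col_i io g`_i.
have BG : B *m G = 0.
  apply/matrixP => i j; rewrite mulmxBl mul_scalar_mx !mxE hT; apply/eqP.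
  rewrite subr_eq0; apply/eqP/eq_bigr => k _; by rewrite !mxE.
have dG (i : 'I_e) : \det B * io g`_i = 0.
  have : \adj B *m B *m G = 0 by rewrite -mulmxA BG mulmx0.
  rewrite mul_adj_mx mul_scalar_mx => /matrixP/(_ i 0).
  by rewrite !mxE.
have [c yE] := (gen_sum g y).1 gy.
apply: (tf_cancel yreg); rewrite yE rmorph_sum mulr_suml big1 // => i _.
by rewrite rmorphM -mulrA [io _ * \det _]mulrC dG mulr0.
Qed.

(** R[v] is finite over R, so it has a common denominator. *)
Lemma almost_integral v : V v ->
  exists2 t, GRing.lreg t & forall i, exists b, v ^+ i * io t = io b.
Proof.
move=> [p pm pv]; have [r [s [sreg vs]]] := total_fractionsP v.
have sp : size p = (size p).-1.+1 by rewrite prednK // size_poly_gt0 monic_neq0.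
set d := (size p).-1 in sp.
have ex := monic_root_expand pm sp pv.
exists (s ^+ d); first exact: lregX.
move=> i; have [k] := ubnP i; elim: k i => // k IHk i; rewrite ltnS => ik.
have [id|di] := ltnP i d.
  exists (r ^+ i * s ^+ (d - i)); rewrite rmorphM !rmorphXn /= -vs exprMn -mulrA -exprD.
  by rewrite subnKC // ltnW.
have : forall j : 'I_d, exists b, v ^+ (i - d + j) * io (s ^+ d) = io b.
  move=> j; apply: IHk; apply: leq_trans ik.
  by rewrite -{2}(subnK di) ltn_add2l.
move=> /choice[b hb]; exists (- \sum_(j < d) p`_j * b j).
rewrite -{1}(subnK di) exprD ex rmorphN rmorph_sum mulrN mulNr; congr (- _).
rewrite mulr_sumr mulr_suml; apply: eq_bigr => j _; rewrite rmorphM /= -hb exprD.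
by ring.
Qed.

End IntegralClosure.

(** * Finiteness of the integral closure *)

Section Finiteness.
Variables (R : comNzRingType) (m : idealr R).
Hypotheses (noethR : noetherian R) (localR : local_ring [set` m]).
Hypotheses (dimR : krull_dim R 1) (redC : reduced (completion m)).
Local Notation Q := (total_fractions R).
Local Notation io := (@tf_embed R).
Local Notation V := (@integral_closure R).

Let redR : reduced R := reduced_of_completion redC noethR localR.

Lemma stable_integral v (I : set R) y :
  idl I -> I y -> GRing.lreg y ->
  (forall a, I a -> exists2 b, I b & v * io a = io b) -> V v.
Proof.
move=> hI Iy yreg; have [g gE] := (noetherianE R).1 noethR I hI.
rewrite gE in Iy * => h; have [p [pm _ pv]] := determinant_trick h Iy yreg.
by exists p.
Qed.

(** R[v] has a conductor in R, an ideal stable under v that contains a regular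
    element; it has e generators with e independent of v. *)
Lemma uniform_degree : exists e, forall v, V v ->
  exists p : {poly R}, [/\ p \is monic, size p = e.+1 & root (map_poly io p) v].
Proof.
have [e he] := bounded_generation noethR localR redR dimR.
exists e => v Vv; have [t treg ht] := almost_integral Vv.
(* The conductor of R[v] in R. *)
pose I := [set a : R | forall i, exists b, v ^+ i * io a = io b].
have hI : idl I.
  split=> [i|a b c Ib Ic i]; first by exists 0; rewrite rmorph0 mulr0.
  have [[b' hb] [c' hc]] := (Ib i, Ic i); exists (a * b' + c').
  by rewrite !rmorphD !rmorphM /= -hb -hc; ring.
have [g sg gE] := he I t hI ht treg.
have [a Ia|||p [pm sp pv]] := @determinant_trick R v g t.
- rewrite -gE in Ia *; have [b hb] := Ia 1%N; exists b; last by rewrite -hb expr1.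
  move=> i; have [c hc] := Ia i.+1; exists c.
  by rewrite -hb -hc expr1 exprSr mulrA.
- by rewrite -gE.
- by [].
- by exists p; rewrite -sg.
Qed.

(** Suppose that for each k some element of R is divisible by x^k in V but not
    by x in R, and let J_k be the ideal of the elements divisible by x^k in V.
    By the descending chain condition the intersection K_k of the J_n + x^k R
    over all n equals J_n + x^k R for large n, so that an element of K_1
    outside xR lifts step by step to a coherent sequence of elements of the
    K_k.  Its limit is nilpotent by uniform_degree, hence 0, a contradiction.
    So some J_N lies in xR, and cancelling x shows x^N V in R. *)
Theorem integral_closure_finite : exists2 x, GRing.lreg x /\ m x &
  forall v, V v -> exists b, io x * v = io b.
Proof.
have [x mx xreg] := regular_in_m noethR localR redR dimR.
have xkreg k : GRing.lreg (x ^+ k) by exact: lregX.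
have [e he] := uniform_degree.
pose J k := [set r : R | exists2 v, V v & io r = io (x ^+ k) * v].
have Ji k : idl (J k).
  split; first by exists 0; [exact: ic0 | rewrite rmorph0 mulr0].
  move=> a r s [v Vv rE] [w Vw sE]; exists (io a * v + w).
    by apply: icD => //; apply: icM => //; exact: ic_tf.
  by rewrite rmorphD rmorphM /= rE sE; ring.
have Jx k c : J k (x ^+ k * c).
  by exists (io c); [exact: ic_tf | rewrite rmorphM].
have Jd k : J k.+1 `<=` J k.
  move=> r [v Vv rE]; exists (io x * v); first by apply: icM => //; exact: ic_tf.
  by rewrite rE exprSr rmorphM mulrA.
have Jdle k l : (k <= l)%N -> J l `<=` J k.
  move=> /subnK <-; elim: (l - k)%N => [|i IHi] // r.
  by rewrite addSn => /Jd; exact: IHi.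
have Jpow k r : J k r -> exists c, r ^+ e = x ^+ k * c.
  move=> [v Vv rE]; have [p [pm sp pv]] := he v Vv.
  move: rE; move: (x ^+ k) => X rE.
  exists (- \sum_(j < e) p`_j * r ^+ j * X ^+ (e - j).-1); apply: tf_embed_inj.
  rewrite rmorphXn /= rE exprMn (monic_root_expand pm sp pv) !mulrN rmorphN /=.
  congr (- _); rewrite rmorphM /= rmorph_sum !mulr_sumr; apply: eq_bigr => j _.
  rewrite !rmorphM !rmorphXn /= rE exprMn.
  have je : e = (j + (e - j).-1.+1)%N by rewrite prednK ?subn_gt0 // subnKC // ltnW.
  by rewrite {1}je exprD exprS; ring.
have [N hN] : exists N, J N `<=` principal x.
  apply: contrapT => hno.
  pose B k n := [set r : R | exists a c, J n a /\ r = a + x ^+ k * c].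
  have Bi k n : idl (B k n).
    split; first by exists 0, 0; split; [exact: idl0 (Ji n) | ring].
    move=> a _ _ [u [c [Ju ->]]] [u' [c' [Ju' ->]]].
    by exists (a * u + u'), (a * c + c'); split; [exact: (Ji n).2 | ring].
  have Bst k : exists n, forall l, B k n `<=` B k (n + l)%N.
    apply: (@dcc R _ noethR localR dimR _ (B k) (xkreg k)) => // n.
      by move=> _ [a [c [/Jd Ja ->]]]; exists a, c.
    by exists 0, 1; split; [exact: idl0 (Ji n) | ring].
  pose K k := [set r : R | forall n, B k n r].
  have KB k : exists n, B k n `<=` K k.
    have [n hn] := Bst k; exists n => r Br l.
    have [a [c [Ja ->]]] := hn l r Br.
    by exists a, c; split=> //; apply: Jdle Ja; exact: leq_addl.
  have [r1 K1 nr1] : exists2 r, K 1%N r & ~ principal x r.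
    have [n hn] := KB 1%N; apply: contrapT => h; apply: hno; exists n => r Jr.
    apply: contrapT => nr; apply: h; exists r => //; apply: hn.
    by exists r, 0; split=> //; ring.
  have step (t : {kr : nat * R | K kr.1 kr.2}) : exists u : {kr : nat * R | K kr.1 kr.2},
      (sval u).1 = (sval t).1.+1 /\ principal (x ^+ (sval t).1) ((sval u).2 - (sval t).2).
    case: t => -[k r] /= Kr; have [n hn] := KB k.+1.
    have [a [c [Ja rE]]] := Kr n.
    have Ka : K k.+1 a by apply: hn; exists a, 0; split=> //; ring.
    by exists (exist _ (k.+1, a) Ka); split=> //=; exists (- c); rewrite rE; ring.
  have [f hf] := choice step.
  pose u n := iter n f (exist _ (1%N, r1) K1).
  have uk n : (sval (u n)).1 = n.+1.
    by elim: n => [|n IHn] //; rewrite (hf (u n)).1 IHn.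
  pose rho n := (sval (u n)).2.
  have rhoK n : K n.+1 (rho n) by rewrite -uk; exact: (svalP (u n)).
  have rhoJ n : J n.+1 (rho n).
    have [a [c [Ja ->]]] := rhoK n n.+1; apply: idlD => //; exact: Jx.
  have rhoS n : principal (x ^+ n.+1) (rho n.+1 - rho n).
    by have := (hf (u n)).2; rewrite uk.
  (* rho n lies in K (n + 1), so one factor x is to spare. *)
  have xm n c : ideal_exp [set` m] n (x ^+ n.+1 * c).
    rewrite exprS -mulrA mulrCA; apply: idlMr; first exact: idl_exp.
    exact: ideal_expX.
  have null := @coherent_nilpotent R m redC rho e.
  have {null} null n : ideal_exp [set` m] n (rho n).
    apply: null => {}n.
      by have [c ->] := rhoS n; rewrite mulrC; exact: xm.
    by have [c ->] := Jpow _ _ (rhoJ n); exact: xm.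
  have [k hk] := exp_m_sub_regular noethR localR dimR xreg.
  apply: nr1; rewrite -[r1]/(rho 0%N).
  have diff n : principal x (rho n - rho 0%N).
    elim: n => [|n IHn]; first by rewrite subrr; exact: idl0 (idl_principal x).
    rewrite -[_ - _](subrKA (rho n)); apply: idlD => //; first exact: idl_principal.
    by have [c ->] := rhoS n; exists (c * x ^+ n); rewrite exprS; ring.
  have := hk _ (null k); rewrite -[rho 0%N](subKr (rho k)) => h.
  by apply: idlB => //; exact: idl_principal.
exists (x ^+ N.+1).
  by split=> //; rewrite exprS mulrC; apply: (idlM (I := [set` m]) _ (m_idl localR)).
suff Nv v : V v -> exists b, io (x ^+ N) * v = io b.
  move=> v /Nv[b hb]; exists (x * b).
  by rewrite exprS !rmorphM /= -mulrA -hb.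
move=> Vv; have [r [s [sreg vs]]] := total_fractionsP v.
have [k [c xk]] := nilpotent_mod_regular noethR localR dimR sreg mx.
have : exists b, io (x ^+ (N + k)) * v = io b.
  exists (x ^+ N * c * r); rewrite exprD xk !rmorphM /= -vs; ring.
elim: k {xk} => [|k IHk]; first by rewrite addn0.
rewrite addnS exprS => -[b hb]; apply: IHk.
have [|c' bE] := hN b.
  by apply: (Jdle N (N + k).+1); [rewrite leqW ?leq_addr | exists v; rewrite ?exprS].
exists c'; apply: (tf_lcancel xreg).
by rewrite mulrA -rmorphM hb bE mulrC rmorphM.
Qed.

End Finiteness.

(** * Modules over the integral closure are projective *)

Section GeneralizedInverse.
Variables (R : comNzRingType) (m : set R) (x : R).
Hypotheses (noethR : noetherian R) (localR : local_ring m).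
Hypotheses (redR : reduced R) (dimR : krull_dim R 1).
Local Notation Q := (total_fractions R).
Local Notation io := (@tf_embed R).
Local Notation V := (@integral_closure R).
Hypotheses (xreg : GRing.lreg x).
Hypothesis xV : forall v, V v -> exists b, io x * v = io b.
Implicit Types (a u v w z : Q).

Definition icmul a : set Q := [set w | exists2 u, V u & w = a * u].

Lemma icmulM a u w : V u -> icmul a w -> icmul a (u * w).
Proof. by move=> Vu [v Vv ->]; exists (u * v); [exact: icM | ring]. Qed.

Lemma icmulD a u w : icmul a u -> icmul a w -> icmul a (u + w).
Proof. by move=> [v Vv ->] [v' Vv' ->]; exists (v + v'); [exact: icD | ring]. Qed.

Lemma icmul0 a : icmul a 0.
Proof. by exists 0; [exact: ic0 | rewrite mulr0]. Qed.

(** Elements of V nilpotent modulo aV form an ideal. *)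
Lemma icmul_expD a u w k l : V u -> V w ->
  icmul a (u ^+ k) -> icmul a (w ^+ l) -> icmul a ((u + w) ^+ (k + l)).
Proof.
move=> Vu Vw Pu Pw; rewrite exprDn; apply: (big_ind (icmul a)).
- exact: icmul0.
- exact: icmulD.
move=> i _; rewrite -mulr_natl; apply: icmulM; first exact: integral_nat.
have [li|il] := leqP l i.
  by rewrite -(subnK li) exprD; do 2 (apply: icmulM; first exact: icX).
have -> : (k + l - i)%N = (l - i + k)%N.
  by move: (nat_of_ord i) il => i' il; rewrite addnC addnBAC // ltnW.
rewrite exprD mulrC; apply: icmulM; first exact: icX.
by apply: icmulM => //; exact: icX.
Qed.

Lemma ic_exp1D (j w : Q) k : V j -> V w -> exists2 w', V w' & (1 + j * w) ^+ k = 1 + j * w'.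
Proof.
move=> Vj Vw; elim: k => [|k [w' Vw' e]].
  by exists 0; [exact: ic0 | rewrite expr0; ring].
exists (w + w' + j * w * w'); last by rewrite exprS e; ring.
by apply: icD; [exact: icD | do 2 apply: icM => //].
Qed.

Lemma ic_horner (p : {poly R}) (j : Q) : V j -> V (map_poly io p).[j].
Proof.
move=> Vj; apply: integral_horner Vj.
by apply/(integral_poly io) => i; rewrite coef_map; exact: ic_tf.
Qed.

(** In a zero-dimensional quotient V / aV, each j in V is a unit on one
    factor and nilpotent on the other.  Explicitly: let e be the least
    exponent whose coefficient in an integral equation of j is not in m.
    The terms below are nilpotent modulo aV, and the rest of the equation is a
    unit of R times j^e (1 + j w). *)
Lemma ic_power_kill a (j : Q) : V j ->
  (forall c, m c -> exists k, icmul a (io c ^+ k)) ->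
  exists k w, V w /\ icmul a (j ^+ k * (1 + j * w)).
Proof.
move=> Vj nil; have [p pm /rootP pj] := Vj.
suff main (q : {poly R}) e : (exists i, ~ m q`_i) ->
    (exists k, icmul a ((j ^+ e * (map_poly io q).[j]) ^+ k)) ->
    exists k w, V w /\ icmul a (j ^+ k * (1 + j * w)).
  apply: (main p 0%N).
    by exists (size p).-1; rewrite -[p`__]/(lead_coef p) (monicP pm); exact: m_not1 localR.
  by exists 1%N; rewrite pj mulr0 expr1; exact: icmul0.
elim/poly_ind: q e => [|q c IHq] e.
  by move=> [i]; rewrite coef0 => /(_ (idl0 (m_idl localR))).
have -> : (map_poly io (q * 'X + c%:P)).[j] = (map_poly io q).[j] * j + io c.
  by rewrite rmorphD rmorphM /= map_polyX map_polyC hornerD hornerMX hornerC.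
set Qj := (map_poly io q).[j]; have VQ : V Qj by exact: ic_horner.
move=> [i ni] [k hk]; have [mc|nc] := pselect (m c).
  have [l hl] := nil c mc; apply: (IHq e.+1).
    case: i ni => [|i]; rewrite coefD coefMX coefC /=; first by rewrite add0r.
    by rewrite addr0 => ni; exists i.
  exists (k + l)%N; rewrite -/Qj.
  have -> : j ^+ e.+1 * Qj = j ^+ e * (Qj * j + io c) + - (j ^+ e * io c).
    by rewrite exprS; ring.
  have Vc : V (io c) by exact: ic_tf.
  have Ve : V (j ^+ e) by exact: icX.
  apply: icmul_expD => //.
  - by apply: icM => //; apply: icD => //; exact: icM.
  - by rewrite -[- _]add0r; apply: icB; [exact: ic0 | exact: icM].
  by rewrite -mulN1r !exprMn; apply: icmulM;
    [apply: icX; rewrite -[-1]add0r; apply: icB; [exact: ic0|exact: ic1]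
    | apply: icmulM => //; exact: icX].
have [b hb] := unit_of_notin_m noethR localR nc.
have Vb : V (io b) by exact: ic_tf.
have [w Vw hw] := ic_exp1D k Vj (icM Vb VQ).
exists (e * k)%N, w; split=> //.
have -> : j ^+ (e * k) * (1 + j * w) = io b ^+ k * (j ^+ e * (Qj * j + io c)) ^+ k.
  rewrite -hw exprM -!exprMn; congr (_ ^+ k).
  have -> : io b * (j ^+ e * (Qj * j + io c)) = j ^+ e * (io b * io c + j * (io b * Qj)) by ring.
  by rewrite -rmorphM hb rmorph1.
by apply: icmulM => //; exact: icX.
Qed.

(** Multiply s by the largest power of each entry in turn that stays outside
    aV. *)
Lemma annihilate_list a s (ws : seq Q) : V s -> ~ icmul a s ->
  (forall w, w \in ws -> V w /\ exists k, icmul a (s * w ^+ k)) ->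
  exists h, [/\ V h, ~ icmul a (s * h) & forall w, w \in ws -> icmul a (s * h * w)].
Proof.
move=> Vs ns; elim: ws => [|w ws IHws] hws.
  by exists 1; split=> //; [exact: ic1 | rewrite mulr1].
have [|h [Vh nh hh]] := IHws.
  by move=> w' w'in; apply: hws; rewrite in_cons w'in orbT.
have [Vw [k hk]] := hws w (mem_head w ws).
have [e ne eS] : exists2 e, ~ icmul a (s * h * w ^+ e) & icmul a (s * h * w ^+ e.+1).
  have : icmul a (s * h * w ^+ k) by rewrite mulrAC mulrC; exact: icmulM.
  elim: k {hk} => [|k IHk]; first by rewrite mulr1.
  have [/IHk//|nk hk] := pselect (icmul a (s * h * w ^+ k)); by exists k.
exists (h * w ^+ e); split.
- by apply: icM => //; exact: icX.
- by rewrite mulrA.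
move=> w'; rewrite in_cons => /orP[/eqP->|/hh hw'].
  by move: eS; rewrite exprS; congr icmul; ring.
have -> : s * (h * w ^+ e) * w' = w ^+ e * (s * h * w') by ring.
by apply: icmulM => //; exact: icX.
Qed.

Lemma common_denominator k (a : 'I_k -> Q) :
  exists2 t, GRing.lreg t & forall i, exists r, io t * a i = io r.
Proof.
have : forall i, exists rs : R * R, GRing.lreg rs.2 /\ a i * io rs.2 = io rs.1.
  by move=> i; have [r [s [sreg e]]] := total_fractionsP (a i); exists (r, s).
move=> /choice[f hf]; exists (\prod_i (f i).2).
  by apply: (big_ind (@GRing.lreg R)) => [||i _]; [exact: lreg1 | exact: lregM | exact: (hf i).1].
move=> i; exists ((f i).1 * \prod_(j | j != i) (f j).2).
by rewrite (bigD1 i) //= rmorphM mulrAC [io _ * a i]mulrC (hf i).2 rmorphM.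
Qed.

(** Let I be the fractional ideal generated by the a_i, D = (V : I) and J = I D.
    If z J lies in V, then z D lies in D; as D is, up to a denominator, an
    ideal of R, z is integral, so (V : J) = V.  If J were proper, pick a unit a0
    of Q in J.  Each element of J is nilpotent modulo a0 V after
    multiplication by a suitable element of 1 + J, and so all elements of J
    kill a nonzero class s' of V / a0 V.  Then s' / a0 is in (V : J) but not
    in V. *)
Lemma fractional_ideal_invertible k (a v : 'I_k -> Q) (q : Q) :
  (forall i, V (v i)) -> (\sum_i v i * a i) * q = 1 ->
  exists y : 'I_k -> Q, (forall i j, V (a i * y j)) /\ \sum_i a i * y i = 1.
Proof.
set u := \sum_i _ => Vv uq.
pose D y := forall i, V (y * a i).
pose J z := exists2 y : 'I_k -> Q, (forall i, D (y i)) & z = \sum_i y i * a i.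
have DM z y : V z -> D y -> D (z * y) by move=> Vz Dy i; rewrite -mulrA; exact: icM.
have DD y y' : D y -> D y' -> D (y + y') by move=> Dy Dy' i; rewrite mulrDl; exact: icD.
have D0 : D 0 by move=> i; rewrite mul0r; exact: ic0.
have JV z : J z -> V z by move=> [y Dy ->]; apply: ic_sum => i; exact: Dy.
have JM z w : V z -> J w -> J (z * w).
  move=> Vz [y Dy ->]; exists (fun i => z * y i); first by move=> i; exact: DM.
  by rewrite mulr_sumr; apply: eq_bigr => i _; ring.
have JD z w : J z -> J w -> J (z + w).
  move=> [y Dy ->] [y' Dy' ->]; exists (fun i => y i + y' i); first by move=> i; exact: DD.
  by rewrite -big_split; apply: eq_bigr => i _ /=; ring.
have J1 y i : D y -> J (y * a i).
  move=> Dy; exists (fun j => if j == i then y else 0); first by move=> j; case: ifP.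
  by rewrite (bigD1 i) //= eqxx big1 ?addr0 // => j /negPf->; rewrite mul0r.
suff [y Dy e] : J 1.
  by exists y; split=> [i j|]; [rewrite mulrC; exact: Dy | rewrite e; apply: eq_bigr => i _; ring].
apply: contrapT => nJ1.
have [t treg ht] := common_denominator a.
have [qt tq] := tf_embed_unit treg; have [qx xq] := tf_embed_unit xreg.
have Dt : D (io t) by move=> i; have [r ->] := ht i; exact: ic_tf.
pose a0 := u * io t.
have a0q : a0 * (q * qt) = 1.
  by rewrite /a0 mulrACA uq tq mulr1.
have Ja0 : J a0.
  exists (fun i => v i * io t); first by move=> i; exact: DM.
  by rewrite /a0 mulr_suml; apply: eq_bigr => i _; ring.
(* (V : J) = V. *)
have key z : (forall w, J w -> V (z * w)) -> V z.
  move=> hz; have Dz y : D y -> D (z * y).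
    by move=> Dy i; rewrite -mulrA; apply: hz; exact: J1.
  have uD y : D y -> V (u * y).
    move=> Dy; rewrite mulr_suml; apply: ic_sum => i; rewrite -mulrA; apply: icM => //.
    by rewrite mulrC.
  pose I := [set r : R | exists2 y, D y & io r = io x * (u * y)].
  have hI : idl I.
    split; first by exists 0; rewrite // rmorph0; ring.
    move=> c r s [y Dy rE] [y' Dy' sE]; exists (io c * y + y').
      by apply: DD => //; apply: DM => //; exact: ic_tf.
    by rewrite rmorphD rmorphM /= rE sE; ring.
  have [r0 r0E] := xV (JV _ Ja0).
  apply: (stable_integral noethR hI (y := r0)).
  - by exists (io t) => //; rewrite -r0E.
  - apply: (@lreg_tf_unit R r0 (qx * (q * qt))).
    by rewrite -r0E mulrACA xq a0q mulr1.
  move=> r [y Dy rE]; have [b bE] := xV (uD _ (Dz _ Dy)); exists b.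
    by exists (z * y); [exact: Dz | rewrite bE].
  by rewrite -bE rE; ring.
have nil c : m c -> exists n, icmul a0 (io c ^+ n).
  move=> mc; have [r [s [sreg rs]]] := total_fractionsP (q * qt).
  have [n [d hd]] := nilpotent_mod_regular noethR localR dimR sreg mc.
  exists n; rewrite -rmorphXn hd /=; exists (io (d * r)); first exact: ic_tf.
  rewrite !rmorphM /= -rs.
  have -> : a0 * (io d * (q * qt * io s)) = (a0 * (q * qt)) * (io d * io s) by ring.
  by rewrite a0q mul1r.
pose I2 := [set r : R | exists2 w, J w & io r = io x * w].
have hI2 : idl I2.
  split; first by exists 0; [exists (fun=> 0) => //; rewrite big1 // => i _; rewrite mul0r | rewrite rmorph0 mulr0].
  move=> c r s [w Jw rE] [w' Jw' sE]; exists (io c * w + w').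
    by apply: JD => //; apply: JM => //; exact: ic_tf.
  by rewrite rmorphD rmorphM /= rE sE; ring.
have [g gE] := (noetherianE R).1 noethR _ hI2.
(* Generators of J over R; x J is an ideal of R. *)
have [ws wsJ gws] : exists2 ws : seq Q, (forall w, w \in ws -> J w) &
    forall r, r \in g -> exists2 w, w \in ws & io r = io x * w.
  have : forall r, r \in g -> I2 r.
    by move=> r rg; rewrite gE; apply: gen_mem => //; exact: idl_set0.
  elim: (g) => [|r s IHs] hs; first by exists [::].
  have [|ws hws sws] := IHs; first by move=> r' r's; apply: hs; rewrite in_cons r's orbT.
  have [w Jw rE] := hs r (mem_head r s); exists (w :: ws).
    by move=> w'; rewrite in_cons => /orP[/eqP->|/hws].
  move=> r'; rewrite in_cons => /orP[/eqP->|/sws[w' w'in e]].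
    by exists w => //; rewrite mem_head.
  by exists w' => //; rewrite in_cons w'in orbT.
have [j Jj hj] : exists2 j, J j & forall w, w \in ws ->
    exists n, icmul a0 ((1 + j) * w ^+ n).
  elim: (ws) wsJ => [|w s IHs] hs.
    by exists 0 => //; rewrite -[0](mul0r a0); apply: JM => //; exact: ic0.
  have [|j Jj hj] := IHs; first by move=> r' r's; apply: hs; rewrite in_cons r's orbT.
  have Jw := hs w (mem_head w s); have Vw := JV _ Jw.
  have [n [w' [Vw' hn]]] := ic_power_kill Vw nil.
  exists (j + (1 + j) * w' * w).
    apply: JD => //; apply: JM => //; apply: icM => //.
    by apply: icD; [exact: ic1 | exact: JV].
  have -> : 1 + (j + (1 + j) * w' * w) = (1 + w * w') * (1 + j) by ring.
  move=> z; rewrite in_cons => /orP[/eqP->|/hj[l hl]].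
    exists n; have -> : (1 + w * w') * (1 + j) * w ^+ n = (1 + j) * (w ^+ n * (1 + w * w')) by ring.
    by apply: icmulM => //; apply: icD; [exact: ic1 | exact: JV].
  exists l; rewrite -mulrA; apply: icmulM => //.
  by apply: icD; [exact: ic1 | exact: icM].
have Vs : V (1 + j) by apply: icD; [exact: ic1 | exact: JV].
have ns : ~ icmul a0 (1 + j).
  move=> [w Vw e]; apply: nJ1; have -> : 1 = w * a0 + (- 1) * j by rewrite [w * a0]mulrC -e; ring.
  apply: JD; apply: JM => //.
  by rewrite -[-1]add0r; apply: icB; [exact: ic0 | exact: ic1].
have [w win|h [Vh nh hh]] := annihilate_list Vs ns (ws := ws).
  by split; [exact/JV/wsJ | exact: hj].
apply: nh; set z := (1 + j) * h * (q * qt).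
exists z; last first.
  have -> : a0 * z = (a0 * (q * qt)) * ((1 + j) * h) by rewrite /z; ring.
  by rewrite a0q mul1r.
apply: key => w Jw.
pose G := [set r : R | exists2 w, V (z * w) & io r = io x * w].
have hG : idl G.
  split; first by exists 0; [rewrite mulr0; exact: ic0 | rewrite rmorph0 mulr0].
  move=> c r s [w1 Vw1 rE] [w2 Vw2 sE]; exists (io c * w1 + w2).
    have -> : z * (io c * w1 + w2) = io c * (z * w1) + z * w2 by ring.
    by apply: icD => //; apply: icM => //; exact: ic_tf.
  by rewrite rmorphD rmorphM /= rE sE; ring.
have [b bE] := xV (JV _ Jw).
have : G b.
  have : I2 b by exists w.
  rewrite gE; apply: gen_sub => //; first by move=> _ ->; exact: idl0.
  move=> r /gws[w1 w1in rE]; exists w1 => //.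
  have [c Vc cE] := hh w1 w1in.
  have -> : z * w1 = (1 + j) * h * w1 * (q * qt) by rewrite /z; ring.
  by rewrite cE mulrAC a0q mul1r.
by move=> [w2 Vw2]; rewrite -bE => /(tf_lcancel xreg) ->.
Qed.

(** Enlarge the fractional ideal by an element s that kills it, so that the sum
    contains a unit of Q, and use invertibility of the sum. *)
Lemma fractional_ideal_dual_basis k (a : 'I_k -> Q) :
  exists y : 'I_k -> Q, (forall i j, V (a i * y j)) /\
    forall j, (\sum_i a i * y i) * a j = a j.
Proof.
have [t treg /choice[r hr]] := common_denominator a.
pose I := [set z : R | exists c : 'I_k -> R, z = \sum_i c i * r i].
have hI : idl I.
  split; first by exists (fun=> 0); rewrite big1 // => i _; rewrite mul0r.
  move=> d _ _ [c ->] [c' ->]; exists (fun i => d * c i + c' i).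
  by rewrite mulr_sumr -big_split; apply: eq_bigr => i _ /=; ring.
have [tau [s [[c tauE] sI reg]]] := regular_split noethR redR hI.
have [q hq] := tf_embed_unit reg.
(* Index 0 carries the added element s; v' are the coefficients of the unit tau + s. *)
pose a' (i : 'I_k.+1) := if unlift ord0 i is Some j then a j else io s.
pose v' (i : 'I_k.+1) := if unlift ord0 i is Some j then io (c j * t) else 1.
have [i||y [Vy yE]] := @fractional_ideal_invertible _ a' v' q.
- by rewrite /v'; case: unlift => [j|]; [exact: ic_tf | exact: ic1].
- rewrite -hq; congr (_ * _); rewrite big_ord_recl /a' /v' !unlift_none mul1r.
  rewrite rmorphD addrC; congr (_ + _); rewrite tauE rmorph_sum; apply: eq_bigr => i _.
  by rewrite !liftK !rmorphM /= -mulrA hr.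
exists (fun j => y (lift ord0 j)); split=> [i j|j].
  by have := Vy (lift ord0 i) (lift ord0 j); rewrite /a' liftK.
have sa : io s * a j = 0.
  apply: (tf_cancel treg); rewrite mulrCA hr -rmorphM sI ?rmorph0 //.
  exists (fun i => if i == j then 1 else 0).
  by rewrite (bigD1 j) //= eqxx mul1r big1 ?addr0 // => i /negPf->; rewrite mul0r.
have a'0 : a' ord0 = io s by rewrite /a' unlift_none.
have a'S i : a' (lift ord0 i) = a i by rewrite /a' liftK.
rewrite -[RHS]mul1r -yE big_ord_recl mulrDl a'0.
rewrite [io s * _ * _]mulrAC sa mul0r add0r; congr (_ * _); apply: eq_bigr => i _.
by rewrite a'S.
Qed.

(** The identity says that right multiplication by W is a section, over V, of
    the map from V^k onto the V-module generated by the rows of A: this module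
    is projective.  Induction on the columns: project onto the first
    coordinate, split off the image, and treat the kernel. *)
Lemma generalized_inverse n k (A : 'M[Q]_(k, n)) :
  exists W : 'M[Q]_(n, k), A *m W *m A = A /\ forall i j, V ((A *m W) i j).
Proof.
elim: n A => [|n IHn] A.
  exists 0; split=> [|i j]; first by rewrite !thinmx0.
  by rewrite mulmx0 mxE; exact: ic0.
rewrite -[n.+1]/(1 + n)%N in A *.
rewrite -(hsubmxK A); move: (lsubmx A) (rsubmx A) => a B {A}.
have [y0 [Vy y0E]] := fractional_ideal_dual_basis (fun i => a i 0).
pose y : 'rV_k := \row_j y0 j.
pose P := a *m y.
have PV i j : V (P i j).
  by rewrite mxE big_ord1 mxE; exact: Vy.
have Pa : P *m a = a.
  apply/matrixP => i j; rewrite (ord1 j) -mulmxA mxE big_ord1 mulrC -[RHS](y0E i).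
  congr (_ * _); rewrite mxE; apply: eq_bigr => l _; by rewrite mxE mulrC.
have [W0 [W0E W0V]] := IHn ((1%:M - P) *m B).
set B' := _ *m B in W0E W0V.
pose W' := W0 *m (1%:M - P).
pose w := y - y *m B *m W'.
have AW : row_mx a B *m col_mx w W' = P + B' *m W0 *m (1%:M - P).
  rewrite mul_row_col.
  have -> : a *m w = P - P *m B *m W' by rewrite /w mulmxBr !mulmxA.
  have -> : B' *m W0 *m (1%:M - P) = B *m W' - P *m B *m W'.
    by rewrite -mulmxA -/W' /B' !mulmxBl mul1mx.
  by rewrite -addrA; congr (_ + _); rewrite addrC.
exists (col_mx w W'); rewrite AW; split; last first.
  move=> i j; rewrite mxE; apply: icD; first exact: PV.
  rewrite mxE; apply: ic_sum => l; apply: icM; first exact: W0V.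
  rewrite mxE; apply: icD; first by rewrite mxE; exact: integral_nat.
  by rewrite mxE; apply: integral_opp; exact: PV.
rewrite mul_mx_row; congr (row_mx _ _); rewrite mulmxDl.
  by rewrite Pa -[_ *m _ *m a]mulmxA mulmxBl mul1mx Pa subrr mulmx0 addr0.
by rewrite -[_ *m _ *m B]mulmxA -/B' W0E /B' mulmxBl mul1mx addrC subrK.
Qed.

(** T = r A W for a generalized inverse W of A. *)
Lemma conductor_factor r k n (A : 'M[R]_(k, n)) : conductor R (io r) ->
  exists T : 'M[R]_k, T *m A = r *: A /\ forall b : 'rV_k, b *m A = 0 -> b *m T = 0.
Proof.
move=> rC; pose AQ := map_mx io A; have [W [AWA AWV]] := generalized_inverse AQ.
have : forall ij : 'I_k * 'I_k, exists c, io r * (AQ *m W) ij.1 ij.2 = io c.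
  by move=> ij; exact: rC.
move=> /choice[T hT]; pose M : 'M[R]_k := \matrix_(i, j) T (i, j).
have ME : map_mx io M = io r *: (AQ *m W).
  by apply/matrixP => i j; rewrite [in LHS]mxE mxE -hT [RHS]mxE.
have inj p q : injective (map_mx io : 'M_(p, q) -> 'M_(p, q)).
  by move=> B C /matrixP e; apply/matrixP => i j; have := e i j; rewrite !mxE => /tf_embed_inj.
exists M; split=> [|b bA]; apply: inj.
  by rewrite map_mxM map_mxZ ME -scalemxAl AWA.
by rewrite map_mxM ME -scalemxAr mulmxA -map_mxM bA !map_mx0 mul0mx scaler0.
Qed.

End GeneralizedInverse.

(** * Submodules and linear maps *)

Section Submodules.
Variables (R : comNzRingType) (V : lmodType R).

Definition subm (S : set V) : Prop :=
  S 0 /\ forall a x y, S x -> S y -> S (a *: x + y).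

Section SubmoduleType.
Variables (S : set V) (hS : subm S).

(** The proof of closedness is an argument so that canonical structures can be
    attached to the predicate. *)
Definition subm_pred of subm S : {pred V} := fun v => `[< S v >].

Fact subm_pred_closed : subsemimod_closed (subm_pred hS).
Proof.
split; first split.
- by apply/asboolP; exact: hS.1.
- move=> u v /asboolP Su /asboolP Sv; apply/asboolP.
  by rewrite -[u]scale1r; exact: hS.2.
- move=> a u /asboolP Su; apply/asboolP; rewrite -[_ *: _]addr0.
  by apply: hS.2 => //; exact: hS.1.
Qed.

HB.instance Definition _ :=
  GRing.isSubmodClosed.Build R V (subm_pred hS) subm_pred_closed.

Record submodule := Submodule {
  submodule_val :> V;
  _ : submodule_val \in subm_pred hS }.

HB.instance Definition _ := [isSub for submodule_val].
HB.instance Definition _ := [Choice of submodule by <:].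
HB.instance Definition _ := [SubChoice_isSubLmodule of submodule by <:].

Lemma submoduleP (u : submodule) : S u.
Proof. by case: u => v /= /asboolP. Qed.

Lemma submodule_ex v : S v -> exists u : submodule, submodule_val u = v.
Proof. by move=> Sv; exists (Submodule (asboolT Sv)). Qed.

Lemma submodule_val_linear : linear submodule_val.
Proof. by move=> a u v. Qed.

Lemma submodule_val_inj : injective submodule_val.
Proof. exact: val_inj. Qed.
End SubmoduleType.

Lemma subm_sum (S : set V) n (f : 'I_n -> V) :
  subm S -> (forall i, S (f i)) -> S (\sum_i f i).
Proof.
move=> hS Sf; apply: (big_ind S); [exact: hS.1 | | by []].
by move=> u v Su Sv; rewrite -[u]scale1r; exact: hS.2.
Qed.

Lemma subm_scale (S : set V) a v : subm S -> S v -> S (a *: v).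
Proof. by move=> hS Sv; rewrite -[_ *: _]addr0; apply: hS.2 => //; exact: hS.1. Qed.

Lemma subm_sub (S : set V) u v : subm S -> S u -> S v -> S (u - v).
Proof.
by move=> hS Su Sv; rewrite addrC -scaleN1r; exact: hS.2.
Qed.

End Submodules.

Section LinearMaps.
Variables (R : comNzRingType).
Implicit Types A B P M : lmodType R.

Lemma linear_ex A B (f : A -> B) : linear f -> exists g : {linear A -> B}, forall x, g x = f x.
Proof.
move=> lf; pose lin := GRing.isLinear.Build R A B *:%R f lf.
by exists (HB.pack_for {linear A -> B} f lin).
Qed.

Lemma corestrict_ex A M (S : set M) (hS : subm S) (f : {linear A -> M}) :
  (forall x, S (f x)) ->
  exists g : {linear A -> submodule hS}, forall x, submodule_val (g x) = f x.
Proof.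
move=> fS; have /choice[g0 hg0] : forall x, exists u : submodule hS, submodule_val u = f x.
  by move=> x; exact: submodule_ex.
have [|g gE] := @linear_ex _ _ g0.
  move=> c x y; apply: submodule_val_inj.
  by rewrite submodule_val_linear !hg0 linearP.
by exists g => x; rewrite gE.
Qed.

(** Projectivity is applied to p regarded as a surjection onto its image. *)
Lemma projective_lift P A B (p : {linear A -> B}) (f : {linear P -> B}) :
  projective_module P -> (forall x, exists a, p a = f x) ->
  exists g : {linear P -> A}, forall x, p (g x) = f x.
Proof.
move=> projP pf; pose S := [set b | exists a, p a = b].
have hS : subm S.
  split; first by exists 0; rewrite linear0.
  by move=> c _ _ [a <-] [a' <-]; exists (c *: a + a'); rewrite linearP.
have [p' p'E] := corestrict_ex hS (fun a => ex_intro _ a (erefl (p a))).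
have [f' f'E] := corestrict_ex hS pf.
have [b|g gE] := projP _ _ p' f'.
  have [a ab] := submoduleP b; exists a.
  by apply: submodule_val_inj; rewrite p'E.
by exists g => x; rewrite -p'E gE f'E.
Qed.

Lemma row_linear n M (a : 'I_n -> M) :
  exists f : {linear 'rV[R]_n -> M}, forall w, f w = \sum_i w 0 i *: a i.
Proof.
apply: linear_ex => c u v; rewrite scaler_sumr -big_split; apply: eq_bigr => i _ /=.
by rewrite !mxE scalerDl scalerA.
Qed.

Lemma row_linearE n M (f : {linear 'rV[R]_n -> M}) w :
  f w = \sum_i w 0 i *: f (delta_mx 0 i).
Proof.
by rewrite {1}(row_sum_delta w) linear_sum; apply: eq_bigr => i _; rewrite linearZ.
Qed.

Lemma row_projective n : projective_module 'rV[R]_n.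
Proof.
move=> A B p f psurj.
have /choice[a ha] : forall i : 'I_n, exists a, p a = f (delta_mx 0 i) by move=> i; exact: psurj.
have [g gE] := row_linear a; exists g => w.
rewrite gE linear_sum [RHS]row_linearE; apply: eq_bigr => i _.
by rewrite linearZ /= ha.
Qed.

Lemma fin_genP M : fin_gen M <->
  exists n, exists f : {linear 'rV[R]_n -> M}, forall x, exists w, f w = x.
Proof.
split=> [[s hs]|[n [f fs]]].
  have [f fE] := row_linear (fun i : 'I_(size s) => s`_i).
  exists (size s), f => x; have [c ->] : Defs.span s x by rewrite hs.
  by exists (\row_i c i); rewrite fE; apply: eq_bigr => i _; rewrite mxE.
exists [seq f (delta_mx 0 i) | i <- enum 'I_n].
apply/predeqP => x; split=> // _; have [w <-] := fs x.
have sz : size [seq f (delta_mx 0 i) | i <- enum 'I_n] = n.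
  by rewrite size_map size_enum_ord.
exists (fun i => w 0 (cast_ord sz i)).
rewrite row_linearE (reindex (cast_ord sz)) /=; last first.
  by exists (cast_ord (esym sz)) => i _; [rewrite cast_ordK | rewrite cast_ordKV].
apply: eq_bigr => i _; congr (_ *: _).
have i_n : (i < n)%N by have := ltn_ord i; rewrite [X in (_ < X)%N]sz.
rewrite (nth_map (cast_ord sz i)); last by rewrite size_enum_ord.
by congr (f (delta_mx _ _)); apply: val_inj; rewrite /= nth_enum_ord.
Qed.

End LinearMaps.

(** * Submodules of free modules *)

Section NoetherianModules.
Variable R : comNzRingType.
Hypothesis noethR : noetherian R.

Lemma row_submodule_fg n (S : set 'rV[R]_n) : subm S ->
  exists k (A : 'M[R]_(k, n)), forall w, S w <-> exists y, w = y *m A.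
Proof.
elim: n S => [|n IHn] S hS.
  exists 0%N, 0 => w; split=> [_|[y ->]]; first by exists 0; rewrite !thinmx0.
  by rewrite mulmx0; exact: hS.1.
rewrite -[n.+1]/(1 + n)%N in S hS *.
have hI : idl [set c | exists2 w, S w & w 0 0 = c].
  split; first by exists 0; [exact: hS.1 | rewrite mxE].
  move=> c _ _ [u Su <-] [v Sv <-]; exists (c *: u + v); first exact: hS.2.
  by rewrite !mxE.
have [g gE] := (noetherianE R).1 noethR _ hI.
have /choice[l hl] : forall i : 'I_(size g), exists w, S w /\ w 0 0 = g`_i.
  move=> i; have : gen [set 0] g g`_i by apply: gen_mem; [exact: idl_set0 | exact: mem_nth].
  by rewrite -gE => -[w Sw e]; exists w.
pose L : 'M[R]_(size g, 1 + n) := \matrix_i l i.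
have LS (y : 'rV_(size g)) : S (y *m L).
  rewrite mulmx_sum_row; apply: subm_sum => // i; apply: subm_scale => //.
  by rewrite rowK; exact: (hl i).1.
have [|k [A hA]] := IHn [set v | S (row_mx 0 v)].
  split; first by rewrite /= row_mx0; exact: hS.1.
  by move=> c u v Su Sv; have := hS.2 c _ _ Su Sv; rewrite scale_row_mx add_row_mx scaler0 addr0.
exists (size g + k)%N, (col_mx L (row_mx 0 A)) => w; split; last first.
  move=> [y ->]; rewrite -[y]hsubmxK mul_row_col mul_mx_row mulmx0.
  have SA : S (row_mx 0 (rsubmx y *m A)) by apply/hA; exists (rsubmx y).
  by rewrite -[_ *m L]scale1r; apply: hS.2.
move=> Sw; have : gen [set 0] g (w 0 0) by rewrite -gE; exists w.
move=> /gen_sum[c cE]; pose y1 : 'rV_(size g) := \row_i c i.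
have Sd : S (w - y1 *m L) by apply: subm_sub.
have d0 : w - y1 *m L = row_mx 0 (rsubmx (w - y1 *m L)).
  rewrite -{1}[w - _]hsubmxK; congr (row_mx _ _); apply/matrixP => i j.
  rewrite (ord1 i) (ord1 j) !mxE; apply/eqP; rewrite subr_eq0; apply/eqP.
  rewrite (_ : lshift n 0 = 0); last exact: val_inj.
  by rewrite cE; apply: eq_bigr => p _; rewrite !mxE (hl p).2.
have [y2 y2E] : exists y, rsubmx (w - y1 *m L) = y *m A.
  by apply/hA; rewrite /= -d0.
exists (row_mx y1 y2); rewrite mul_row_col mul_mx_row mulmx0 -y2E -d0.
by rewrite addrC subrK.
Qed.

Lemma submodule_fin_gen n (S : set 'rV[R]_n) (hS : subm S) : fin_gen (submodule hS).
Proof.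
have [k [A hA]] := row_submodule_fg hS.
have [|f fE] := corestrict_ex (f := mulmxr A) hS; first by move=> y; apply/hA; exists y.
apply/fin_genP; exists k, f => u; have [y yE] := (hA _).1 (submoduleP u).
by exists y; apply: submodule_val_inj; rewrite fE.
Qed.

Lemma linear_kernel_subm (A B : lmodType R) (f : {linear A -> B}) : subm [set x | f x = 0].
Proof.
split; first by rewrite /= linear0.
by move=> a x y /= fx fy; rewrite linearP fx fy scaler0 addr0.
Qed.

Lemma kernel_cover n (M : lmodType R) (f : {linear 'rV[R]_n -> M}) :
  exists k (A : 'M[R]_(k, n)), forall w, f w = 0 <-> exists y, w = y *m A.
Proof. exact: (row_submodule_fg (linear_kernel_subm f)). Qed.

Lemma matrix_kernel_cover n p (A : 'M[R]_(n, p)) :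
  exists kB : {k & 'M[R]_(k, n)}, forall w : 'rV_n,
    w *m A = 0 <-> exists y, w = y *m projT2 kB.
Proof.
by have [k [B hB]] := kernel_cover (mulmxr A); exists (existT _ k B).
Qed.

End NoetherianModules.

(** * Annihilation of Ext *)

Section ExtAnnihilation.
Variables (R : comNzRingType).
Implicit Types (X Y M : lmodType R) (r : R).

Lemma ext_annihilatorP X Y (P : proj_resolution X) i r :
  annihilator (Ext Y P i.+1) r <->
  forall f : P i.+1 -> Y, linear f -> (forall x, f (res_diff P i.+1 x) = 0) ->
    exists g : {linear P i -> Y}, forall x, r *: f x = g (res_diff P i x).
Proof.
split=> [h f lf f0|h q].
  have fP : f \in @ext_cocycle R X Y P i.+1 by apply/asboolP.
  have := h (\pi_(Ext Y P i.+1) (Cocycle fP)).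
  rewrite [_ *: _]quot_scale_pi => /eqP.
  by rewrite quot_pi_eq0 => /asboolP[g hg]; exists g => x; rewrite -hg.
have [[f fP] ->] := quot_piP q.
rewrite [_ *: _]quot_scale_pi; apply/eqP; rewrite quot_pi_eq0; apply/asboolP.
have /asboolP[lf f0] := fP; have [g hg] := h f lf f0.
by exists g => x; rewrite -hg.
Qed.

Lemma projective_lift_kernel (P A B C : lmodType R) (d : {linear A -> B})
    (d' : {linear B -> C}) (f : P -> B) :
  projective_module P -> (forall x, d' x = 0 -> exists a, x = d a) ->
  linear f -> (forall x, d' (f x) = 0) ->
  exists g : {linear P -> A}, forall x, d (g x) = f x.
Proof.
move=> projP ex lf f0; have [f' f'E] := linear_ex lf.
have [|g gE] := @projective_lift _ P _ _ d f' projP.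
  by move=> x; have [a e] := ex _ (f0 x); exists a; rewrite f'E.
by exists g => x; rewrite gE.
Qed.

Lemma res_diff_diff X (P : proj_resolution X) n x : res_diff P n (res_diff P n.+1 x) = 0.
Proof. by apply/res_exact; exists x. Qed.

Lemma res_aug_diff X (P : proj_resolution X) x : res_aug P (res_diff P 0 x) = 0.
Proof. by apply/res_exact0; exists x. Qed.

(** Let A be a presentation matrix of the syzygy of X.  By comparison with the
    resolution P, multiplication by r on the syzygy ker (P_0 -> X) factors
    through the sum of a free module and P_0, and the factorization lifts
    to a map s : P_1 -> P_2 with d s d = r d.  This relation propagates to all
    degrees, and f (s d) = r f for each cocycle f. *)
Lemma ext_annihilator_of_factor r X Y (P : proj_resolution X) i :
  noetherian R ->
  (forall k n (A : 'M[R]_(k, n)), exists T : 'M[R]_k,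
    T *m A = r *: A /\ forall b : 'rV_k, b *m A = 0 -> b *m T = 0) ->
  fin_gen X -> (2 <= i)%N -> annihilator (Ext Y P i) r.
Proof.
move=> noethR fact /fin_genP[n [p psurj]].
have homotopy j : exists s : {linear P j.+1 -> P j.+2},
    forall q, res_diff P j.+1 (s (res_diff P j.+1 q)) = r *: res_diff P j.+1 q.
  elim: j => [|j [s sE]]; last first.
    have [|||t tE] := @projective_lift_kernel (P j.+2) _ _ _ (res_diff P j.+2)
      (res_diff P j.+1) (fun q => r *: q - s (res_diff P j.+1 q)) (@res_proj _ _ P _).
    - by move=> x /res_exact.
    - by move=> a u v; rewrite scalerDr !scalerA [r * a]mulrC scalerBr scalerA (linearP (res_diff P j.+1)) (linearP s) opprD addrACA.
    - by move=> q; rewrite linearB linearZ /= sE subrr.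
    exists t => q; rewrite tE res_diff_diff linear0 subr0 //.
  have [al alE] := projective_lift (@res_proj _ _ P 0%N) (fun x => psurj (res_aug P x)).
  have [be beE] := projective_lift (@row_projective R n) (fun w => res_aug_surj P (p w)).
  have [k [A hA]] := kernel_cover noethR p.
  have [T [TA hT]] := fact k n A.
  have [|||b bE] := @projective_lift_kernel (P 1%N) _ _ _ (mulmxr A)
     p (fun q => al (res_diff P 0 q)) (@res_proj _ _ P _).
  - by move=> w /hA.
  - by move=> a u v; rewrite !linearP.
  - by move=> q; rewrite alE res_aug_diff.
  have [|||u uE] := @projective_lift_kernel 'rV_k _ _ _ (res_diff P 0) (res_aug P)
     (fun y => be (y *m A)) (@row_projective R k).
  - by move=> x /res_exact0.
  - by move=> a y z; rewrite mulmxDl -scalemxAl linearP.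
  - by move=> y; rewrite beE; apply/hA; exists y.
  (* 1 - be al maps P_0 into the syzygy ker (P_0 -> X). *)
  have [|||t tE] := @projective_lift_kernel (P 0%N) _ _ _ (res_diff P 0) (res_aug P)
     (fun x => x - be (al x)) (@res_proj _ _ P _).
  - by move=> x /res_exact0.
  - by move=> a y z; rewrite (linearP al) (linearP be) scalerBr opprD addrACA.
  - by move=> y; rewrite linearB /= beE alE subrr.
  have [|||s sE] := @projective_lift_kernel (P 1%N) _ _ _ (res_diff P 1) (res_diff P 0)
     (fun q => r *: q - u (b q *m T) - t (r *: res_diff P 0 q)) (@res_proj _ _ P _).
  - by move=> x /res_exact.
  - move=> a y z; rewrite (linearP (res_diff P 0)) (linearP b) mulmxDl -scalemxAl.
    rewrite (linearP u) !scalerDr !scalerN !scalerA [r * a]mulrC -(scalerA a r (res_diff P 0 y)).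
    by rewrite (linearP t) !opprD -[RHS]addrACA; congr (_ + _); exact: addrACA.
  - move=> q; rewrite !linearB !linearZ /= uE tE -mulmxA TA -scalemxAr linearZ /=.
    have := bE q; rewrite /= => ->.
    by rewrite -scalerBr -scalerDr subrr scaler0.
  exists s => q; rewrite sE res_diff_diff scaler0 linear0 subr0.
  have bA : b (res_diff P 1 q) *m A = 0.
    by have := bE (res_diff P 1 q); rewrite /= => ->; rewrite res_diff_diff linear0.
  by rewrite (hT _ bA) linear0 subr0.
case: i => [|[|i]] // _; apply/ext_annihilatorP => f lf f0.
have [s sE] := homotopy i.
have [f' f'E] := linear_ex lf.
exists (f' \o s)%FUN => x /=.
have [y yE] : exists y, r *: x - s (res_diff P i.+1 x) = res_diff P i.+2 y.
  by apply/res_exact; rewrite linearB linearZ /= sE subrr.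
have := f0 y; rewrite -yE -f'E linearB linearZ /= !f'E => /eqP.
by rewrite subr_eq0 => /eqP.
Qed.

Definition kills r i M : Prop := forall Y (P : proj_resolution M) j,
  fin_gen Y -> (i <= j)%N -> annihilator (Ext Y P j) r.

Section ShortExact.
Variables (M' F M : lmodType R) (inj : {linear M' -> F}) (p : {linear F -> M}).
Hypotheses (projF : projective_module F) (injI : injective inj).
Hypotheses (psurj : forall x, exists y, p y = x).
Hypothesis exactF : forall y, p y = 0 <-> exists x, y = inj x.

Section Splice.
Variable P : proj_resolution M'.

(** A resolution of M' preceded by F is a resolution of M. *)
Definition splice_mod (n : nat) : lmodType R :=
  match n with 0 => F | k.+1 => P k end%N.

Definition splice_diff (n : nat) : {linear splice_mod n.+1 -> splice_mod n} :=
  match n with 0 => (inj \o res_aug P)%FUN | k.+1 => res_diff P k end%N.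

Lemma splice_proj n : projective_module (splice_mod n).
Proof. by case: n => [|n] //=; exact: res_proj. Qed.

Lemma splice_exact0 y : p y = 0 <-> exists q, y = splice_diff 0 q.
Proof.
split=> [/exactF[x ->]|[q ->]]; last by apply/exactF; exists (res_aug P q).
by have [q <-] := res_aug_surj P x; exists q.
Qed.

Lemma splice_exact n y :
  splice_diff n y = 0 <-> exists q, y = splice_diff n.+1 q.
Proof.
case: n y => [|n] y /=; last exact: res_exact.
rewrite -res_exact0; split=> [|->]; last by rewrite linear0.
by rewrite -[X in _ = X](linear0 inj) => /injI.
Qed.

Definition splice : proj_resolution M :=
  ProjResolution splice_proj psurj splice_exact0 splice_exact.

End Splice.

(** Dimension shifting, valid on the level of cocycles: the spliced resolution
    has the same differentials in positive degrees. *)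
Lemma kills_syzygy r i : kills r i.+2 M -> kills r i.+1 M'.
Proof.
move=> h Y P [|j] // fY ij; apply/ext_annihilatorP => f lf f0.
exact: ((ext_annihilatorP Y (splice P) j.+1 r).1 (h Y (splice P) j.+2 fY ij) f lf f0).
Qed.

(** Apply the hypothesis to the class of the extension of M by M' given by F,
    whose cocycle is the augmentation P_0 -> M'. *)
Lemma kills_extension r (P : proj_resolution M') : fin_gen M' -> kills r 1 M ->
  exists g : {linear F -> M'}, forall y, g (inj y) = r *: y.
Proof.
move=> fM h.
have [||g gE] := (ext_annihilatorP M' (splice P) 0 r).1 (h _ (splice P) 1%N fM isT) (res_aug P).
- exact: linearP.
- by move=> x /=; rewrite res_aug_diff.
exists g => y; have [q <-] := res_aug_surj P y.
by rewrite gE.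
Qed.

End ShortExact.
End ExtAnnihilation.

(** * Free resolutions by matrices *)

Section FreeResolution.
Variable R : comNzRingType.
Hypothesis noethR : noetherian R.

(** Resolutions are iterated over the type of matrices of all sizes, so that
    consecutive sizes match by computation. *)
Definition any_matrix := {a & {b & 'M[R]_(a, b)}}.
Definition nrows (s : any_matrix) := projT1 s.
Definition ncols (s : any_matrix) := projT1 (projT2 s).
Definition mat_of (s : any_matrix) : 'M[R]_(nrows s, ncols s) := projT2 (projT2 s).

Definition pack_matrix (a b : nat) (A : 'M[R]_(a, b)) : any_matrix := existT _ a (existT _ b A).

Definition cover (s : any_matrix) := projT1 (cid (matrix_kernel_cover noethR (mat_of s))).

Definition syzygy (s : any_matrix) : any_matrix := pack_matrix (projT2 (cover s)).

Lemma syzygyP s (w : 'rV_(nrows s)) :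
  w *m mat_of s = 0 <-> exists y : 'rV_(nrows (syzygy s)), w = y *m mat_of (syzygy s).
Proof. exact: (projT2 (cid (matrix_kernel_cover noethR (mat_of s)))). Qed.

Section Resolution.
Variable s0 : any_matrix.
Definition res_rank n := ncols (iter n syzygy s0).
Definition res_mat n : 'M[R]_(res_rank n.+1, res_rank n) := mat_of (iter n syzygy s0).

Lemma res_mat_exact n (w : 'rV_(res_rank n.+1)) :
  w *m res_mat n = 0 <-> exists y : 'rV_(res_rank n.+2), w = y *m res_mat n.+1.
Proof. exact: syzygyP. Qed.
End Resolution.

Lemma resolution_ex (M : lmodType R) : fin_gen M -> exists P : proj_resolution M, True.
Proof.
move=> /fin_genP[n [f fs]]; have [k [A hA]] := kernel_cover noethR f.
pose s0 := pack_matrix A.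
unshelve eexists (@ProjResolution R M (fun n => 'rV[R]_(res_rank s0 n))
  (fun n => mulmxr (res_mat s0 n)) f _ fs _ _) => //.
- by move=> i; exact: row_projective.
- by move=> i w; exact: res_mat_exact.
Qed.

End FreeResolution.

(** * Baer's criterion and exactness of duals *)

Section Baer.
Variable R : comNzRingType.
Implicit Types (E J Y C : lmodType R).

Definition linear_rel E (G : R -> E -> Prop) : Prop :=
  G 0 0 /\ forall a u w u' w', G u w -> G u' w' -> G (a * u + u') (a *: w + w').

(** A homomorphism defined on an ideal, given by its graph: homomorphisms can
    then be composed and extended without choosing total functions. *)
Definition partial_hom E (G : R -> E -> Prop) : Prop :=
  linear_rel G /\ forall w, G 0 w -> w = 0.

Definition baer E : Prop := forall G, partial_hom G ->
  exists y : E, forall u w, G u w -> w = u *: y.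

Definition baer_regular E : Prop := forall G, partial_hom G ->
  (exists s w, GRing.lreg s /\ G s w) ->
  exists y : E, forall u w, G u w -> w = u *: y.

Definition divisible E : Prop :=
  forall s, GRing.lreg s -> forall y : E, exists z, s *: z = y.

Lemma linear_rel_dom E (G : R -> E -> Prop) : linear_rel G -> idl [set u | exists w, G u w].
Proof.
move=> [G0 Gl]; split; first by exists 0.
by move=> a u v [w Gw] [w' Gw']; exists (a *: w + w'); exact: Gl.
Qed.

Lemma partial_hom_inj E (G : R -> E -> Prop) u w w' :
  partial_hom G -> G u w -> G u w' -> w = w'.
Proof.
move=> [[G0 Gl] G1] Gw Gw'; apply/eqP; rewrite -subr_eq0; apply/eqP/G1.
have := Gl (-1) _ _ _ _ Gw' Gw.
by rewrite mulN1r scaleN1r addNr addrC.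
Qed.

Lemma injective_baer J : injective_module J -> baer J.
Proof.
move=> injJ G hG; have [[G0 Gl] G1] := hG.
pose S : set R^o := [set u | exists w, G u w].
have hS : subm S by exact: (linear_rel_dom hG.1).
have /choice[f0 hf0] : forall u : submodule hS, exists w, G (submodule_val u) w.
  by move=> u; exact: submoduleP u.
have [|f fE] := @linear_ex R _ _ f0.
  move=> a u v; apply: (partial_hom_inj hG (hf0 _)).
  by rewrite submodule_val_linear; exact: Gl.
have [i iE] := linear_ex (submodule_val_linear (hS := hS)).
have [|g gE] := injJ _ _ i f.
  by move=> u v; rewrite !iE; exact: submodule_val_inj.
exists (g 1) => u w Guw; have [u' u'E] : exists u' : submodule hS, submodule_val u' = u.
  by apply: submodule_ex; exists w.
have := gE u'; rewrite iE fE u'E => e.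
have -> : u *: g 1 = g u by rewrite -linearZ /= -[u *: _]/(u * 1) mulr1.
rewrite e; apply: (partial_hom_inj hG Guw); rewrite -u'E; exact: hf0.
Qed.

Lemma baer_divisible J : baer J -> divisible J.
Proof.
move=> bJ s sreg y; pose G u w := exists c, u = c * s /\ w = c *: y.
have [|z hz] := bJ G.
  split; first split.
  - by exists 0; rewrite mul0r scale0r.
  - move=> a _ _ _ _ [c [-> ->]] [d [-> ->]]; exists (a * c + d).
    by rewrite scalerDl scalerA mulrDl mulrA.
  - move=> _ [c [e ->]]; rewrite (_ : c = 0) ?scale0r //.
    by apply: sreg; rewrite mulr0 mulrC.
by exists z; rewrite -(hz s y) //; exists 1; rewrite mul1r scale1r.
Qed.

(** Baer's criterion for ideals gives extension of homomorphisms from submodules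
    of R^l, one coordinate at a time. *)
Lemma baer_iterate E n l (B : 'M[R]_(n, l)) (h : {linear 'rV[R]_n -> E}) :
  baer E -> (forall x, x *m B = 0 -> h x = 0) ->
  exists c : 'I_l -> E, forall x, h x = \sum_j (x *m B) 0 j *: c j.
Proof.
move=> bE; elim: l B h => [|l IHl] B h hB.
  exists (fun=> 0) => x; rewrite big_ord0; apply: hB; exact: thinmx0.
rewrite -[l.+1]/(1 + l)%N in B hB *.
move: hB; rewrite -(hsubmxK B); move: (lsubmx B) (rsubmx B) => B1 B2 {B} hB.
pose G u w := exists x, [/\ x *m B2 = 0, u = (x *m B1) 0 0 & w = h x].
have [|c0 hc0] := bE G.
  split; first split.
  - by exists 0; rewrite !mul0mx linear0 mxE.
  - move=> a _ _ _ _ [x [x2 -> ->]] [y [y2 -> ->]]; exists (a *: x + y).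
    by rewrite !mulmxDl -!scalemxAl x2 y2 scaler0 addr0 linearP !mxE.
  - move=> _ [x [x2 e ->]]; apply: hB; rewrite mul_mx_row x2.
    rewrite (_ : x *m B1 = 0) ?row_mx0 //.
    by apply/matrixP => i j; rewrite (ord1 i) (ord1 j) -e mxE.
have [|h' h'E] := @linear_ex R _ _ (fun x => h x - (x *m B1) 0 0 *: c0).
  move=> a x y; rewrite linearP mulmxDl -scalemxAl !mxE scalerDl -scalerA.
  by rewrite scalerBr opprD addrACA.
have [|c hc] := IHl B2 h'.
  by move=> x x2; rewrite h'E (hc0 ((x *m B1) 0 0) (h x)) ?subrr //; exists x.
exists (fun j => match split j with inl _ => c0 | inr j' => c j' end) => x.
rewrite big_split_ord big_ord1 /= mul_mx_row.
have -> : h x = (x *m B1) 0 0 *: c0 + h' x by rewrite h'E addrC subrK.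
rewrite hc row_mxEl (unsplitK (inl _)); congr (_ + _); apply: eq_bigr => j _.
by rewrite row_mxEr (unsplitK (inr _)).
Qed.

(** With Ext^1 (-, J) = Ext^1 (-, C) = 0 one has Ext^2 (-, R) = 0.  The rows of
    B generate ker A, whose first syzygy is ker B; the functional w on
    R^n / ker B, a submodule of R^b, has to be extended to R^b.  It extends with
    values in J; modulo R the extension vanishes on the image of B, hence
    factors through the image of A and extends from there to R^l with values
    in C; a lift to J of that map corrects the first extension. *)
Lemma dual_exact (J C : lmodType R) (i : {linear R^o -> J}) (p : {linear J -> C})
    n b l (A : 'M[R]_(b, l)) (B : 'M[R]_(n, b)) (w : 'cV[R]_n) :
  injective i -> (forall c, exists y, p y = c) ->
  (forall y, p y = 0 <-> exists r, y = i r) -> baer J -> baer C ->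
  (forall z : 'rV_b, z *m A = 0 <-> exists y, z = y *m B) ->
  (forall x : 'rV_n, x *m B = 0 -> x *m w = 0) ->
  exists v, w = B *m v.
Proof.
move=> iI psurj exactJ bJ bC exAB hw.
have [|h hE] := @linear_ex R 'rV[R]_n J (fun x => i ((x *m w) 0 0)).
  by move=> a x y; rewrite mulmxDl -scalemxAl !mxE linearP.
have [|t tE] := baer_iterate (B := B) (h := h) bJ.
  by move=> x xB; rewrite hE hw // mxE linear0.
have [H HE] := row_linear (fun j => p (t j)).
have [|s' s'E] := baer_iterate (B := A) (h := H) bC.
  move=> y /exAB[z ->]; rewrite HE.
  have -> : \sum_j (z *m B) 0 j *: p (t j) = p (h z).
    by rewrite tE linear_sum; apply: eq_bigr => j _; rewrite linearZ.
  by rewrite hE; apply/exactJ; exists ((z *m w) 0 0).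
have /choice[s hs] : forall j, exists y, p y = s' j by move=> j; exact: psurj.
have /choice[v hv] : forall j, exists v, t j - \sum_k A j k *: s k = i v.
  move=> j; apply/exactJ; rewrite linearB linear_sum.
  have := s'E (delta_mx 0 j); rewrite HE -rowE.
  rewrite (bigD1 j) //= big1 ?addr0 => [|k kj]; last by rewrite mxE (negPf kj) andbF scale0r.
  rewrite mxE !eqxx scale1r => ->; apply/eqP; rewrite subr_eq0; apply/eqP.
  by apply: eq_bigr => k _; rewrite linearZ /= hs mxE.
have BA : B *m A = 0.
  by apply/row_matrixP => k; rewrite row_mul row0; apply/exAB; exists (delta_mx 0 k); rewrite rowE.
exists (\col_j v j); apply/matrixP => k j; rewrite (ord1 j); apply: iI.
have := tE (delta_mx 0 k); rewrite hE -!rowE mxE => ->.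
rewrite mxE linear_sum.
have -> : \sum_q (row k B) 0 q *: t q =
    \sum_q (i (B k q * v q) + B k q *: \sum_k0 A q k0 *: s k0).
  apply: eq_bigr => q _; rewrite mxE -[B k q * v q]/(B k q *: (v q : R^o)) linearZ /= -hv.
  by rewrite -scalerDr subrK.
rewrite big_split /= [X in _ + X](_ : _ = 0) ?addr0.
  by apply: eq_bigr => q _; rewrite mxE.
under eq_bigr => q _ do rewrite scaler_sumr.
rewrite exchange_big /= big1 // => k0 _.
under eq_bigr => q _ do rewrite scalerA.
by rewrite -scaler_suml; have /matrixP/(_ k k0) := BA; rewrite !mxE => ->; rewrite scale0r.
Qed.

End Baer.

(** * Gorenstein rings of dimension one *)

Section Gorenstein.
Variables (R : comNzRingType) (m : set R).
Hypotheses (noethR : noetherian R) (localR : local_ring m).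
Hypotheses (redR : reduced R) (dimR : krull_dim R 1).

(** A homomorphism from I extends by 0 to I + Rs, where s kills I, because
    I and Rs meet in 0. *)
Lemma baer_regular_baer (E : lmodType R) : baer_regular E -> baer E.
Proof.
move=> bE G [[G0 Gl] G1].
have hI := linear_rel_dom (conj G0 Gl).
have [t [s [[wt Gt] sI reg]]] := regular_split noethR redR hI.
pose G' u w := exists u0 c, G u0 w /\ u = u0 + c * s.
have [||y hy] := bE G'.
- split; first split.
  + by exists 0, 0; split=> //; rewrite mul0r addr0.
  + move=> a _ w _ w' [u [c [Gu ->]]] [u' [c' [Gu' ->]]].
    by exists (a * u + u'), (a * c + c'); split; [exact: Gl | ring].
  + move=> w [u [c [Gu e]]]; apply: G1; rewrite (_ : 0 = u) //.
    apply/esym/(sq_eq0 redR).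
    have su : s * u = 0 by apply: sI; exists w.
    have -> : u * u = (u + c * s) * u - c * (s * u) by ring.
    by rewrite -e su mul0r mulr0 subr0.
- by exists (t + s), wt; split=> //; exists t, 1; rewrite mul1r.
by exists y => u w Gu; apply: hy; exists u, 0; split=> //; ring.
Qed.

(** Vanishing of Ext^1 (R / I, -) for ideals I with a regular element passes
    from Y' to Y.  For I = m: the obstruction is an element t' of Y' killed by
    m.  As R / m embeds in R / xR by the class of z, t' = z w' with x w' = 0;
    since Y is divisible, w' lifts to an element w1 of J with x w1 = 0, and
    z w1 is killed by m and lifts t'.  For general I, a maximal extension of
    the homomorphism is defined on all of R, since otherwise the case of m
    extends it to a socle element of the quotient. *)
Lemma baer_regular_cosyzygy (Y J Y' : lmodType R) (i : {linear Y -> J}) (p : {linear J -> Y'}) :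
  injective i -> (forall c, exists y, p y = c) ->
  (forall y, p y = 0 <-> exists r, y = i r) ->
  baer J -> divisible Y -> baer_regular Y' -> baer_regular Y.
Proof.
move=> iI psurj exactJ bJ divY bY'.
have [x mx xreg] := regular_in_m noethR localR redR dimR.
have nx1 : ~ principal x 1.
  move=> [c e]; apply: (m_not1 localR); rewrite e; exact: (idlM c (m_idl localR) mx).
have [z nz hz] := socle noethR localR dimR xreg (idl_principal x) (principal_id x) nx1.
have pi0 y : p (i y) = 0 by apply/exactJ; exists y.
have kcase (H : R -> Y -> Prop) : partial_hom H -> (forall a w, H a w -> m a) ->
    (forall a, m a -> exists w, H a w) -> exists y, forall a w, H a w -> w = a *: y.
  move=> [[H0 Hl] H1] Hm mH.
  have [|t ht] := bJ (fun a w => exists2 w0, H a w0 & w = i w0).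
    split; first split.
    - by exists 0 => //; rewrite linear0.
    - by move=> a u _ u' _ [w Hw ->] [w' Hw' ->]; exists (a *: w + w'); [exact: Hl | rewrite linearP].
    - by move=> _ [w /H1-> ->]; rewrite linear0.
  have mt a : m a -> a *: p t = 0.
    by move=> /mH[w Hw]; rewrite -linearZ /= -(ht a (i w)) ?pi0 //; exists w.
  have cz c : principal x (c * z) -> m c.
    move=> h; apply: contrapT => nc; apply: nz.
    have [d hd] := unit_of_notin_m noethR localR nc.
    exact: (idl_unit (idl_principal x) hd h).
  have [||w' hw'] := bY' (fun u w => exists c d, u = c * z + d * x /\ w = c *: p t).
  - split; first split.
    + by exists 0, 0; rewrite scale0r; split=> //; ring.
    + move=> a _ _ _ _ [c [d [-> ->]]] [c' [d' [-> ->]]].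
      exists (a * c + c'), (a * d + d'); split; first by ring.
      by rewrite scalerDl scalerA.
    + move=> _ [c [d [e ->]]]; apply/mt/cz; exists (- d).
      by rewrite -[LHS](addrK (d * x)) -e; ring.
  - by exists x, 0; split=> //; exists 0, 1; rewrite scale0r; split=> //; ring.
  have zw' : p t = z *: w' by apply: hw'; exists 1, 0; rewrite scale1r; split=> //; ring.
  have xw' : x *: w' = 0 by apply/esym/hw'; exists 0, 1; rewrite scale0r; split=> //; ring.
  have [w wE] := psurj w'.
  have [y1 y1E] : exists y, x *: w = i y by apply/exactJ; rewrite linearZ /= wE.
  have [y0 y0E] := divY x xreg y1.
  pose w1 := w - i y0.
  have xw1 : x *: w1 = 0 by rewrite scalerBr y1E -y0E linearZ subrr.
  have [y2 y2E] : exists y, t - z *: w1 = i y.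
    by apply/exactJ; rewrite linearB linearZ /= linearB /= pi0 subr0 wE zw' subrr.
  exists y2 => a w0 Hw; apply: iI.
  have mz : a *: (z *: w1) = 0.
    have [d hd] := hz a (Hm _ _ Hw).
    by rewrite scalerA hd -scalerA xw1 scaler0.
  rewrite (ht a (i w0)); last by exists w0.
  by rewrite linearZ /= -y2E scalerBr mz subr0.
move=> G hG [s [ws [sreg Gs]]].
(* The general case: extend G to an ideal I that is maximal for this purpose. *)
pose ext (G' : R -> Y -> Prop) := partial_hom G' /\ forall u w, G u w -> G' u w.
have [I [[G' [[hG' GG'] ->]] Imax]] := @noetherian_maximal R
  (fun I => exists G', ext G' /\ I = [set u | exists w, G' u w]) [set u | exists w, G u w] noethR
  ltac:(by move=> I [G' [[hG' _] ->]]; exact: (linear_rel_dom hG'.1))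
  (ex_intro _ G (conj (conj hG (fun _ _ h => h)) erefl)).
have [[G'0 G'l] G'1] := hG'.
have hI := linear_rel_dom hG'.1.
have [[y Gy]|n1] := pselect (exists w, G' 1 w).
  exists y => u w /GG' Gu; apply: (partial_hom_inj hG' Gu).
  by have := G'l u 1 y 0 0 Gy G'0; rewrite mulr1 !addr0.
have [||b nb hb] := @socle R m noethR localR dimR s _ sreg hI.
- by exists ws; exact: GG'.
- exact: n1.
have cb c : (exists w, G' (c * b) w) -> m c.
  move=> h; apply: contrapT => nc; apply: nb.
  have [d hd] := unit_of_notin_m noethR localR nc.
  exact: (idl_unit hI hd h).
have [|||y hy] := kcase (fun a w => G' (a * b) w).
- split; first split.
  + by rewrite mul0r.
  + by move=> a u w u' w' Gu Gu'; rewrite mulrDl -mulrA; exact: G'l.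
  + by move=> w; rewrite mul0r; exact: G'1.
- by move=> a w Ga; apply: cb; exists w.
- by move=> a ma; exact: hb.
pose G2 u w := exists u0 w0 c, [/\ G' u0 w0, u = u0 + c * b & w = w0 + c *: y].
case: nb; apply: (Imax [set u | exists w, G2 u w]).
- exists G2; split=> //; split; first split; first split.
  + by exists 0, 0, 0; split=> //; rewrite ?mul0r ?scale0r addr0.
  + move=> a _ _ _ _ [u [w [c [Gu -> ->]]]] [u' [w' [c' [Gu' -> ->]]]].
    exists (a * u + u'), (a *: w + w'), (a * c + c'); split; [exact: G'l | ring |].
    by rewrite scalerDr scalerDl scalerA addrACA.
  + move=> _ [u [w [c [Gu e ->]]]].
    have Gc : G' (c * b) (- w).
      have := G'l (-1) _ _ _ _ Gu G'0; rewrite !addr0 scaleN1r mulN1r.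
      by rewrite (_ : - u = c * b) // -[RHS](addKr u) -e addr0.
    by rewrite -(hy c _ Gc) subrr.
  + move=> u w /GG' Gu; exists u, w, 0; split=> //; by rewrite ?mul0r ?scale0r addr0.
- move=> u [w Gu]; exists w, u, w, 0; split=> //; by rewrite ?mul0r ?scale0r addr0.
- by exists y, 0, 0, 1; rewrite mul1r scale1r !add0r.
Qed.

Lemma divisible_quotient (J C : lmodType R) (p : {linear J -> C}) :
  (forall c, exists y, p y = c) -> divisible J -> divisible C.
Proof.
move=> psurj divJ s sreg c; have [y <-] := psurj c.
by have [z <-] := divJ s sreg y; exists (p z); rewrite linearZ.
Qed.

Lemma inj_dim_baer_regular n (Y : lmodType R) :
  inj_dim_le n Y -> divisible Y -> baer_regular Y.
Proof.
elim: n Y => [|n IHn] Y /=.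
  by move=> /injective_baer bY _ G hG _; exact: bY.
move=> [J [C [i [p [/injective_baer bJ iI psurj ex /IHn bC]]]]] divY.
apply: (baer_regular_cosyzygy iI psurj ex bJ divY); apply: bC.
exact: divisible_quotient psurj (baer_divisible bJ).
Qed.

(** Case of injective dimension 0: R would be divisible, contradicting that m
    contains a regular element.  Otherwise the first cosyzygy satisfies Baer's
    criterion. *)
Theorem gorenstein_dual_exact n0 : inj_dim_le n0 (R^o : lmodType R) ->
  forall n b l (A : 'M[R]_(b, l)) (B : 'M[R]_(n, b)) (w : 'cV[R]_n),
  (forall z : 'rV_b, z *m A = 0 <-> exists y, z = y *m B) ->
  (forall x : 'rV_n, x *m B = 0 -> x *m w = 0) ->
  exists v, w = B *m v.
Proof.
case: n0 => [|n0] /=.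
  move=> /injective_baer/baer_divisible divR; exfalso.
  have [x mx xreg] := regular_in_m noethR localR redR dimR.
  have [z xz] := divR x xreg 1.
  apply: (m_not1 localR); rewrite -xz -[x *: z]/(x * z).
  exact: (idlMr _ (m_idl localR) mx).
move=> [J [C [i [p [/injective_baer bJ iI psurj ex idC]]]]] n b l A B w.
apply: (dual_exact iI psurj ex bJ); apply: baer_regular_baer.
apply: (inj_dim_baer_regular idC).
exact: divisible_quotient psurj (baer_divisible bJ).
Qed.

End Gorenstein.

(** * The conductor *)

Section Conductor.
Variables (R : comNzRingType).
Local Notation io := (@tf_embed R).
Local Notation V := (@integral_closure R).

Definition conductor_ideal : set R := [set c | conductor R (io c)].

Lemma conductor_ideal_idl : idl conductor_ideal.
Proof.
split=> [y _|a c d hc hd y Vy]; first by exists 0; rewrite rmorph0 mul0r.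
have [[s sE] [t tE]] := (hc y Vy, hd y Vy); exists (a * s + t).
by rewrite !rmorphD !rmorphM /= -sE -tE; ring.
Qed.

Lemma conductor_ideal_ic c v : conductor_ideal c -> V v ->
  exists2 d, conductor_ideal d & v * io c = io d.
Proof.
move=> hc Vv; have [d dE] := hc v Vv; exists d; last by rewrite mulrC.
by move=> y Vy; rewrite -dE -mulrA; apply: hc; exact: icM.
Qed.

(** The rows b with b B^T = 0 are the functionals on the ideal C, given by
    their values on the generators c.  Let w be the functional a |-> v a.  The
    hypothesis yields r w = sum_i w_i G_i with w_i = v c_i in C, so that on
    an element x of C one has r v x = sum_i w_i G_i(x) = x sum_i G_i(w_i), by
    R-linearity of the functionals.  Cancelling x, r v = sum_i G_i(w_i). *)
Lemma conductor_of_dual_factor r x N (c : 'cV[R]_N) p (B : 'M[R]_(p, N)) (G : 'I_N -> 'rV[R]_N) :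
  GRing.lreg x -> conductor_ideal x ->
  (forall a, conductor_ideal a <-> exists y : 'rV_N, (y *m c) 0 0 = a) ->
  (forall y : 'rV_N, y *m c = 0 <-> exists z, y = z *m B) ->
  (forall i, G i *m B^T = 0) ->
  (forall w, w *m B^T = 0 -> r *: w = \sum_i w 0 i *: G i) ->
  conductor R (io r).
Proof.
move=> xreg xC cC cB GB rG v Vv.
have ker0 (b y : 'rV_N) : b *m B^T = 0 -> y *m c = 0 -> y *m b^T = 0.
  move=> bB /cB[z ->]; rewrite -mulmxA -[B]trmxK -trmx_mul bB trmx0 mulmx0 //.
have cl l : conductor_ideal (c l 0).
  by apply/cC; exists (delta_mx 0 l); rewrite -rowE mxE.
have /choice[d hd] : forall l, exists d, conductor_ideal d /\ v * io (c l 0) = io d.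
  by move=> l; have [d Cd e] := conductor_ideal_ic (cl l) Vv; exists d.
pose w : 'rV_N := \row_l d l.
have dotw (y : 'rV_N) : v * io ((y *m c) 0 0) = io ((y *m w^T) 0 0).
  rewrite !mxE !rmorph_sum mulr_sumr; apply: eq_bigr => l _.
  by rewrite !mxE !rmorphM /= -(hd l).2; ring.
have wB : w *m B^T = 0.
  apply: trmx_inj; rewrite trmx_mul trmxK trmx0; apply/row_matrixP => i.
  rewrite row_mul row0; apply/matrixP => a b; rewrite (ord1 a) (ord1 b) [RHS]mxE.
  apply: tf_embed_inj; rewrite rmorph0 -dotw.
  have -> : row i B *m c = 0 by apply/cB; exists (delta_mx 0 i); rewrite rowE.
  by rewrite mxE rmorph0 mulr0.
have /choice[mu hmu] : forall i, exists y : 'rV_N, (y *m c) 0 0 = d i.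
  by move=> i; apply/cC; exact: (hd i).1.
have [y yE] := (cC x).1 xC.
exists (\sum_i (mu i *m (G i)^T) 0 0).
(* Both sides are the value of the functional G i at x * d i. *)
have sym i : x * (mu i *m (G i)^T) 0 0 = d i * (y *m (G i)^T) 0 0.
  have e0 : (x *: mu i - d i *: y) *m c = 0.
    rewrite mulmxBl -!scalemxAl; move: (hmu i) yE.
    move: (mu i *m c) (y *m c) => a b aE bE; apply/matrixP => j l.
    by rewrite (ord1 j) (ord1 l) !mxE aE bE mulrC subrr.
  have := ker0 (G i) _ (GB i) e0; rewrite mulmxBl -!scalemxAl => /matrixP/(_ 0 0).
  move: (mu i *m _) (y *m _) => a b; rewrite !mxE => /eqP.
  by rewrite subr_eq0 => /eqP.
apply: (tf_lcancel xreg).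
rewrite -rmorphM mulr_sumr (eq_bigr _ (fun i _ => sym i)).
have -> : io x * (io r * v) = io r * (v * io x) by ring.
rewrite -{1}yE dotw -rmorphM; congr io.
have -> : r * (y *m w^T) 0 0 = (y *m (r *: w)^T) 0 0.
  by rewrite linearZ /= -scalemxAr [RHS]mxE.
rewrite (rG w wB) linear_sum mulmx_sumr summxE; apply: eq_bigr => i _.
by rewrite linearZ /= -scalemxAr !mxE.
Qed.

End Conductor.

(** * The cohomology annihilator *)

Section CohomologyAnnihilator.
Variables (R : comNzRingType) (m : idealr R).
Hypotheses (gorR : gorenstein_local [set` m]) (dimR : krull_dim R 1).
Hypothesis redC : reduced (completion m).
Local Notation io := (@tf_embed R).

Let noethR : noetherian R := let: And3 h _ _ := gorR in h.
Let localR : local_ring [set` m] := let: And3 _ h _ := gorR in h.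
Let redR : reduced R := reduced_of_completion redC noethR localR.

Lemma conductor_sub_ca r n : (2 <= n)%N -> conductor R (io r) -> ca_ R n r.
Proof.
move=> n2 rC X Y fX _ P i ni.
have [x [xreg _] xV] := integral_closure_finite noethR localR dimR redC.
have fact k l (A : 'M[R]_(k, l)) := conductor_factor noethR localR redR dimR xreg xV A rC.
exact: (ext_annihilator_of_factor noethR fact fX (leq_trans n2 ni)).
Qed.

(** Take a free resolution B of C with B 0 the column of generators.  The
    modules Z j are the images of the dual maps for j >= 1, and the kernel K0
    of the first dual map is Hom(C, R). *)
Lemma ca_sub_conductor r n : ca_ R n r -> conductor R (io r).
Proof.
move=> rca.
have [x [xreg _] xV] := integral_closure_finite noethR localR dimR redC.
have xC : conductor_ideal x by move=> v /xV.
have [g gE] := (noetherianE R).1 noethR _ (@conductor_ideal_idl R).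
pose N := size g; pose c : 'cV[R]_N := \col_i g`_i.
pose s0 := pack_matrix c.
pose k j := res_rank noethR s0 j.
pose B j : 'M[R]_(k j.+1, k j) := res_mat noethR s0 j.
pose Z j := [set w : 'rV[R]_(k j.+1) | exists y : 'rV_(k j), w = y *m (B j)^T].
have hZ j : subm (Z j).
  split; first by exists 0; rewrite mul0mx.
  by move=> a _ _ [y ->] [z ->]; exists (a *: y + z); rewrite mulmxDl -scalemxAl.
have [_ _ [n0 idR]] := gorR.
have exZ j (w : 'rV_(k j.+2)) : w *m (B j.+2)^T = 0 <-> Z j.+1 w.
  split=> [wB|[y ->]]; last first.
    rewrite -mulmxA -trmx_mul (_ : B j.+2 *m B j.+1 = 0) ?trmx0 ?mulmx0 //.
    apply/row_matrixP => i; rewrite row_mul row0; apply/res_mat_exact.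
    by exists (delta_mx 0 i); rewrite rowE.
  have [||v vE] := gorenstein_dual_exact noethR localR redR dimR idR
     (A := B j) (B := B j.+1) (w := w^T).
  - exact: res_mat_exact.
  - move=> y /res_mat_exact[z ->].
    by rewrite -mulmxA -[_ *m w^T]trmxK trmx_mul trmxK wB trmx0 mulmx0.
  by exists v^T; rewrite -trmx_mul -vE trmxK.
pose D j : {linear 'rV[R]_(k j) -> 'rV[R]_(k j.+1)} := mulmxr (B j)^T.
have Dex j : exists p : {linear 'rV[R]_(k j) -> submodule (hZ j)},
    (forall y, submodule_val (p y) = y *m (B j)^T) /\
    (forall u, exists y, p y = u).
  have [|p pE] := corestrict_ex (f := D j) (hZ j); first by move=> y; exists y.
  exists p; split=> // u; have [y yE] := submoduleP u.
  by exists y; apply: submodule_val_inj; rewrite pE.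
have killZ j i : (n <= i)%N -> kills r i (submodule (hZ j)).
  move=> ni Y P l fY il; apply: rca => //; last exact: leq_trans il.
  exact: submodule_fin_gen.
have shift i j : kills r i.+2 (submodule (hZ j.+2)) -> kills r i.+1 (submodule (hZ j.+1)).
  have [p [pE psurj]] := Dex j.+2.
  have [io' ioE] := linear_ex (submodule_val_linear (hS := hZ j.+1)).
  apply: (@kills_syzygy R _ _ _ io' p (@row_projective R _)) => //.
    by move=> u v; rewrite !ioE; exact: submodule_val_inj.
  move=> y; split=> [/(congr1 (@submodule_val _ _ _ _))|[u ->]].
    rewrite pE => /exZ/(submodule_ex (hZ j.+1))[u uE].
    by exists u; rewrite ioE.
  by apply: submodule_val_inj; rewrite pE ioE; apply/exZ; exact: submoduleP.
have descend i j : kills r i.+1 (submodule (hZ (i + j).+1)) ->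
    kills r 1 (submodule (hZ j.+1)).
  by elim: i => [|i IHi] //; rewrite addSn => /shift/IHi.
have kill1 : kills r 1 (submodule (hZ 1%N)) by apply: (descend n 0%N); exact: killZ.
pose K0 := [set w : 'rV[R]_(k 1%N) | w *m (B 1%N)^T = 0].
have hK : subm K0 by exact: (linear_kernel_subm (mulmxr (B 1%N)^T)).
have fK := submodule_fin_gen noethR hK.
have [P _] := resolution_ex noethR fK.
have [p [pE psurj]] := Dex 1%N.
have [io' ioE] := linear_ex (submodule_val_linear (hS := hK)).
have [||G GE] := @kills_extension R _ _ _ io' p (@row_projective R _) _ psurj _ r P fK kill1.
- by move=> u v; rewrite !ioE; exact: submodule_val_inj.
- move=> y; split=> [/(congr1 (@submodule_val _ _ _ _))|[u ->]].
    by rewrite pE => /(submodule_ex hK)[u uE]; exists u; rewrite ioE.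
  by apply: submodule_val_inj; rewrite pE ioE; exact: (submoduleP u).
apply: (@conductor_of_dual_factor R r x N c _ (B 1%N) (fun i => submodule_val (G (delta_mx 0 i)))) => //.
- move=> a; rewrite gE gen_sum; split=> [[y ->]|[y <-]].
    by exists (\row_i y i); rewrite mxE; apply: eq_bigr => i _; rewrite !mxE.
  by exists (y 0); rewrite mxE; apply: eq_bigr => i _; rewrite mxE.
- move=> y; exact: (@res_mat_exact R noethR s0 0%N y).
- by move=> i; exact: (submoduleP (G (delta_mx 0 i))).
move=> w wB; have [u uE] := submodule_ex hK wB.
have := GE u; rewrite ioE uE row_linearE => /(congr1 (@submodule_val _ _ _ _)).
have [io2 io2E] := linear_ex (submodule_val_linear (hS := hK)).
rewrite -!io2E linear_sum linearZ /= io2E uE => <-.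
by apply: eq_bigr => i _; rewrite linearZ /= io2E.
Qed.

End CohomologyAnnihilator.

Theorem proposition4p2 (R : comNzRingType) (m : idealr R)
    (hR : gorenstein_local [set` m]) (hdim : krull_dim R 1)
    (hred : reduced (completion m)) (n : nat) (hn : (2 <= n)%N) :
  ca R = ca_ R n /\ @tf_embed R @` ca_ R n = conductor R.
Proof.
have sub := conductor_sub_ca hR hdim hred hn.
split.
  rewrite eqEsubset; split=> r; last first.
    by move=> rn; exists n => //; exact: leq_trans hn.
  by move=> [k _ /(ca_sub_conductor hR hdim hred)/sub].
rewrite eqEsubset; split=> [_ [r rn <-]|z zC]; first exact: ca_sub_conductor hR hdim hred _ _ rn.
have [r rE] := zC 1 (ic1 R); rewrite mulr1 in rE.
by exists r; [apply: sub; rewrite -rE | rewrite rE].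
Qed.
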